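(* Let $A$ be a unital $C^*$-algebra. The map $\iota: K_1(A)\to L_1(A)$ given by $\iota([u])=[(u,1)]$ for unitaries $u$ in matrix algebras over $A$ (with $1$ the unit of the same matrix algebra) is a natural isomorphism.
   Context: Balanced pairs: let $B$ be a $C^*$-algebra (possibly non-unital; the unit below is only for convenience of notation, the relations make sense after expanding). A pair $(a,b)$ of contractions in $B$ (elements of norm $\le 1$) is called balanced if it satisfies the relations (R1) or the relations (R2), where (R1): $a^*a=b^*b$, $aa^*=bb^*$, $a(1-a^*a)=b(1-b^*b)$, $(1-aa^* )a=(1-bb^* )b$; (R2): $(a-b)c=(a^*-b^* )c=0$ for $c$ being any of $1-a^*a,\ 1-aa^*,\ 1-b^*b,\ 1-bb^*$. Two pairs $(a_0,b_0)$, $(a_1,b_1)$ in $B$ are homotopy equivalent if there are continuous paths $(a_t)$, $(b_t)$, $t\in[0,1]$, in $B$ connecting $a_0$ with $a_1$ and $b_0$ with $b_1$ such that $(a_t,b_t)$ is balanced for every $t$. A pair is homotopy trivial if it is homotopy equivalent to $(0,0)$. The group $L_1(A)$: consider balanced pairs in $M_n(A)$, $n\ge 1$, where $M_n(A)\subset M_{n+k}(A)$ is the upper left corner inclusion (so pairs of different matrix sizes can be compared). Two balanced pairs $(a_0,b_0)$, $(a_1,b_1)$ in $M_n(A)$ are equivalent if for some $m$ there is a homotopy trivial pair $(a,b)$ in $M_m(A)$ such that $(a_0\oplus a,b_0\oplus b)$ and $(a_1\oplus a,b_1\oplus b)$ are homotopy equivalent in $M_{n+m}(A)$. $[(a,b)]$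 denotes the equivalence class, and $[(a,b)]+[(c,d)]=[(a\oplus c,b\oplus d)]$. The equivalence classes of balanced pairs form an abelian group, denoted $L_1(A)$, with neutral element $[(0,0)]$. Pairs of unitaries are balanced, and $\iota$ is a homomorphism. *)

(* Defs.v *)
From HB Require Import structures.
From mathcomp Require Import all_boot all_order all_algebra.
From mathcomp Require Import complex.
From mathcomp Require Import all_classical all_reals all_analysis.

Set Implicit Arguments.
Unset Strict Implicit.
Unset Printing Implicit Defensive.

Import Order.TTheory GRing.Theory Num.Theory.
Import numFieldNormedType.Exports.

Local Open Scope classical_set_scope.
Local Open Scope complex_scope.
Local Open Scope ring_scope.

(* Unital complex C*-algebras; the zero algebra is allowed. The norm of a
   normed module over [R[i]] takes its values in [R[i]], hence [cstar_norm] and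
   [cmul_norm] live there. The product is a field of the mixin, and the ring
   structure is derived from it below, because Hierarchy Builder rejects a
   direct join of [pzRingType] and [completeNormedModType] ([numDomainType]
   already inherits from rings and normed groups). *)
HB.mixin Record isUnitalCstar (R : realType) A
    of CompleteNormedModule R[i] A := {
  cmul : A -> A -> A;
  cone : A;
  star : A -> A;
  cmulA : associative cmul;
  cmul1r : left_id cone cmul;
  cmulr1 : right_id cone cmul;
  cmulDl : left_distributive cmul +%R;
  cmulDr : right_distributive cmul +%R;
  cmul_scalel : forall (c : R[i]) (x y : A), cmul (c *: x) y = c *: cmul x y;
  cmul_scaler : forall (c : R[i]) (x y : A), cmul x (c *: y) = c *: cmul x y;
  cmul_norm : forall x y : A, `|cmul x y| <= `|x| * `|y|;
  starK : involutive star;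
  starD : {morph star : x y / x + y};
  starZ : forall (c : R[i]) (x : A), star (c *: x) = c^* *: star x;
  starM : forall x y : A, star (cmul x y) = cmul (star y) (star x);
  cstar_norm : forall x : A, `|cmul (star x) x| = `|x| ^+ 2
}.

#[short(type="ucstarType")]
HB.structure Definition UnitalCstar (R : realType) :=
  { A of CompleteNormedModule R[i] A & isUnitalCstar R A }.

#[non_forgetful_inheritance]
HB.instance Definition _ (R : realType) (A : ucstarType R) :=
  GRing.Zmodule_isPzRing.Build A (@cmulA R A) (@cmul1r R A) (@cmulr1 R A)
    (@cmulDl R A) (@cmulDr R A).

Definition unital_star_hom (R : realType) (A B : ucstarType R) (f : A -> B) :=
  [/\ linear f, monoid_morphism f & {morph f : x / star x}].

Section MatrixAlgebra.
Context (R : realType) (A : ucstarType R).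

Definition adjmx m n (T : 'M[A]_(m, n)) : 'M[A]_(n, m) := (map_mx star T)^T.

(* Norm of the Hilbert module A^n, i.e. the square root of
   ||\sum_i x_i^* x_i||. *)
Definition hnorm n (x : 'cV[A]_n) : R :=
  Num.sqrt (complex.Re `|\sum_i star (x i 0) * x i 0|).

(* The C*-norm of M_n(A): the operator norm of M_n(A) acting on A^n. *)
Definition mxnorm n (T : 'M[A]_n) : R :=
  sup [set hnorm (T *m x) | x in [set x : 'cV[A]_n | hnorm x <= 1]].

Definition mx_contraction n (a : 'M[A]_n) := mxnorm a <= 1.

Definition balancedR1 n (a b : 'M[A]_n) :=
  [/\ adjmx a *m a = adjmx b *m b,
      a *m adjmx a = b *m adjmx b,
      a *m (1%:M - adjmx a *m a) = b *m (1%:M - adjmx b *m b) &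
      (1%:M - a *m adjmx a) *m a = (1%:M - b *m adjmx b) *m b].

Definition balancedR2 n (a b : 'M[A]_n) :=
  forall c : 'M[A]_n,
    c \in [:: 1%:M - adjmx a *m a; 1%:M - a *m adjmx a;
              1%:M - adjmx b *m b; 1%:M - b *m adjmx b] ->
    (a - b) *m c = 0 /\ (adjmx a - adjmx b) *m c = 0.

Definition balanced n (a b : 'M[A]_n) :=
  [/\ mx_contraction a, mx_contraction b & balancedR1 a b \/ balancedR2 a b].

Definition is_unitary n (u : 'M[A]_n) :=
  adjmx u *m u = 1%:M /\ u *m adjmx u = 1%:M.

Definition norm_path n (f : R -> 'M[A]_n) :=
  forall t : R, t \in `[0, 1] ->
    mxnorm (f s - f t) @[s --> within `[0, 1] (nbhs t)] --> (0 : R).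

Definition homotopic n (a0 b0 a1 b1 : 'M[A]_n) :=
  exists a b : R -> 'M[A]_n,
    [/\ norm_path a, norm_path b,
        [/\ a 0 = a0, b 0 = b0, a 1 = a1 & b 1 = b1] &
        forall t : R, t \in `[0, 1] -> balanced (a t) (b t)].

Definition homotopy_trivial n (a b : 'M[A]_n) := homotopic a b 0 0.

Definition unitary_homotopic n (u v : 'M[A]_n) :=
  exists f : R -> 'M[A]_n,
    [/\ norm_path f, f 0 = u, f 1 = v &
        forall t : R, t \in `[0, 1] -> is_unitary (f t)].

Definition dsum m n (a : 'M[A]_m) (b : 'M[A]_n) : 'M[A]_(m + n) :=
  block_mx a 0 0 b.

End MatrixAlgebra.

(* Sets of equivalence classes. [G] is the set of objects being classified,
   and [qlift]/[qlift2] are the operations on classes induced by operations on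
   objects: the union of the classes of the images of all representatives, so
   that no choice of representatives is made. *)
Section Classes.
Context (X : Type) (G : set X) (eqv : X -> X -> Prop).

Definition eqv_class (x : X) : set X := [set y | G y /\ eqv x y].

Definition eqv_classes : set (set X) := [set eqv_class x | x in G].

Definition qlift Y (f : Y -> X) (C : set Y) : set X :=
  \bigcup_(y in C) eqv_class (f y).

Definition qlift2 (op : X -> X -> X) (C D : set X) : set X :=
  \bigcup_(x in C) \bigcup_(y in D) eqv_class (op x y).

End Classes.

Definition abelian_group_on T (G : set T) (add : T -> T -> T) (zero : T) :=
  [/\ G zero,
      forall x y, G x -> G y -> G (add x y),
      forall x y z, G x -> G y -> G z -> add x (add y z) = add (add x y) z,
      forall x y, G x -> G y -> add x y = add y x &
      forall x, G x -> add zero x = x /\ exists2 y, G y & add y x = zero].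

Section K1.
Context (R : realType) (A : ucstarType R).

Record sqmx := SqMx { sqdim : nat; sqval : 'M[A]_sqdim }.

Definition unitaries : set sqmx :=
  [set u | (0 < sqdim u)%N /\ is_unitary (sqval u)].

(* [u] and [v] become homotopic in the unitary group of some M_N(A) once they
   are extended by units. *)
Definition K1_eqv (u v : sqmx) :=
  exists k l (e : (sqdim u + k = sqdim v + l)%N),
    unitary_homotopic
      (castmx (e, e) (dsum (sqval u) (1%:M : 'M[A]_k)))
      (dsum (sqval v) (1%:M : 'M[A]_l)).

Definition sq_dsum (u v : sqmx) := SqMx (dsum (sqval u) (sqval v)).

Definition K1_class : sqmx -> set sqmx := eqv_class unitaries K1_eqv.
Definition K1 : set (set sqmx) := eqv_classes unitaries K1_eqv.
Definition K1_add : set sqmx -> set sqmx -> set sqmx :=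
  qlift2 unitaries K1_eqv sq_dsum.
Definition K1_zero : set sqmx := K1_class (SqMx (1%:M : 'M[A]_1)).

End K1.

Arguments unitaries {R} A.
Arguments K1 {R} A.
Arguments K1_add {R A}.
Arguments K1_zero {R} A.

Section L1.
Context (R : realType) (A : ucstarType R).

Record mxpair :=
  MxPair { pdim : nat; pfst : 'M[A]_pdim; psnd : 'M[A]_pdim }.

Definition balanced_pairs : set mxpair :=
  [set p | (0 < pdim p)%N /\ balanced (pfst p) (psnd p)].

Definition L1_eqv_mx n (a0 b0 a1 b1 : 'M[A]_n) :=
  exists m (a b : 'M[A]_m),
    [/\ (0 < m)%N, homotopy_trivial a b &
        homotopic (dsum a0 a) (dsum b0 b) (dsum a1 a) (dsum b1 b)].

(* The upper left corner inclusion of M_n(A) into M_(n+k)(A). *)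
Definition corner n k (a : 'M[A]_n) : 'M[A]_(n + k) :=
  dsum a (0 : 'M[A]_k).

(* Pairs of possibly different sizes are compared in a common M_N(A). *)
Definition L1_eqv (p q : mxpair) :=
  exists k l (e : (pdim p + k = pdim q + l)%N),
    L1_eqv_mx
      (castmx (e, e) (corner k (pfst p))) (castmx (e, e) (corner k (psnd p)))
      (corner l (pfst q)) (corner l (psnd q)).

Definition pair_dsum (p q : mxpair) :=
  MxPair (dsum (pfst p) (pfst q)) (dsum (psnd p) (psnd q)).

Definition L1_class : mxpair -> set mxpair := eqv_class balanced_pairs L1_eqv.
Definition L1 : set (set mxpair) := eqv_classes balanced_pairs L1_eqv.
Definition L1_add : set mxpair -> set mxpair -> set mxpair :=
  qlift2 balanced_pairs L1_eqv pair_dsum.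
Definition L1_zero : set mxpair := L1_class (MxPair (0 : 'M[A]_1) 0).

Definition unitary_pair (u : sqmx A) : mxpair := MxPair (sqval u) 1%:M.

Definition iota1 : set (sqmx A) -> set mxpair :=
  qlift balanced_pairs L1_eqv unitary_pair.

End L1.

Arguments balanced_pairs {R} A.
Arguments L1 {R} A.
Arguments L1_add {R A}.
Arguments L1_zero {R} A.
Arguments iota1 {R A}.

Section Functoriality.
Context (R : realType) (A B : ucstarType R) (phi : A -> B).

Definition sq_map (u : sqmx A) : sqmx B := SqMx (map_mx phi (sqval u)).
Definition pair_map (p : mxpair A) : mxpair B :=
  MxPair (map_mx phi (pfst p)) (map_mx phi (psnd p)).

Definition K1_map : set (sqmx A) -> set (sqmx B) :=
  qlift (unitaries B) (@K1_eqv R B) sq_map.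
Definition L1_map : set (mxpair A) -> set (mxpair B) :=
  qlift (balanced_pairs B) (@L1_eqv R B) pair_map.

End Functoriality.

(* Main.v *)
Require Import Defs.
From HB Require Import structures.
From mathcomp Require Import all_boot all_order all_algebra.
From mathcomp Require Import complex.
From mathcomp Require Import all_classical all_reals all_analysis.
From mathcomp Require Import zify ring lra.
Import Defs.

(** A pair [(a, b)] that satisfies (R2) also satisfies (R1), and for a pair that
    satisfies (R1) the element [w = 1 - a (a - b)^*] is unitary, with [a = w b].
    It depends continuously on the pair, turns direct sums into direct sums,
    and is [u] for the pair [(u, 1)] and [1] for the pair [(0, 0)], so that
    [(a, b) |-> w] induces a left inverse of [iota].

    It is also a right inverse. Once there is room next to the support [e] of
    [(a, b)], say a partial isometry [v] with [v v^* = e] and [v e = 0], the pair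
      [(cos t a + sin t w v, cos t b + sin t v)]
    stays balanced ([rotation_balR1]) and leads from [(a, b)] to [(w v, v)].
    The pair [(w e, e)] has the same unitary [w], hence is homotopic to
    [(w v, v)] too, and [(w e + t (1 - e), e + t (1 - e))] leads from it to
    [(w, 1)] ([filling_balR1]). Therefore two balanced pairs are equivalent if
    and only if their unitaries are ([L1_eqvE]), and every statement about the
    group L_1 follows from the corresponding one about K_1. Naturality is then
    the compatibility of [w] with star homomorphisms.

    For K_1, an isometry [S : A^n -> A^N] embeds the unitary [u] as
    [1 + S (u - 1) S^*], and two isometries with orthogonal ranges are joined by
    the path of isometries [cos t S + sin t T] ([uh_emb_orth]). With enough room
    the class of the embedded unitary therefore does not depend on [S]. In
    particular [u (+) v], the product of two embedded unitaries, is stably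
    homotopic to [u v], and the group laws follow.

    The analytic input is that the norms on [A^n] and on [M_n(A)] behave as they
    should and that contractivity of [a] is an algebraic property: [1 - a^* a]
    has the form [k^* k] ([contractionP]). This passes to direct sums, to the
    rotations above, and to images under star homomorphisms. It rests on the
    positivity of [x^* x] ([adjM_Pos]), which is proved without spectral theory:
    square roots come from an iteration, an element [p] such that
    [p^2 + q^2 = 1] with [p], [q] self-adjoint and commuting is the real part of
    the unitary [p + i q], and an element [y] such that [y^* y <= 0 <= y y^*]
    vanishes by Bernoulli's inequality. *)

Set Implicit Arguments.
Unset Strict Implicit.
Unset Printing Implicit Defensive.

Import Order.TTheory GRing.Theory Num.Theory.
Import numFieldNormedType.Exports.

Local Open Scope classical_set_scope.
Local Open Scope ring_scope.

(** * Identities in noncommutative rings *)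

(** Both sides of an identity are expanded into sums of signed monomials. The
    atoms [NCcst] are meant for central elements. *)
Inductive ncexpr :=
  | NCvar of nat | NCcst of nat | NC0 | NC1
  | NCadd of ncexpr & ncexpr | NCopp of ncexpr | NCmul of ncexpr & ncexpr.

Section NCRing.
Variable T : pzRingType.
Implicit Types (env cst : seq T) (v w : seq nat).

Fixpoint nceval cst env e : T :=
  match e with
  | NCvar i => nth 0 env i
  | NCcst i => nth 0 cst i
  | NC0 => 0
  | NC1 => 1
  | NCadd a b => nceval cst env a + nceval cst env b
  | NCopp a => - nceval cst env a
  | NCmul a b => nceval cst env a * nceval cst env b
  end.

(** A sign, a word in the central atoms and a word in the other atoms. The first
    word is kept sorted, so that moving a central factor does not change the
    monomial. *)
Definition ncmonom := (bool * (seq nat * seq nat))%type.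
Implicit Types (m : ncmonom) (s : seq ncmonom).

Definition ncword env w : T := foldr (fun i x => nth 0 env i * x) 1 w.

Definition ncmono cst env m : T :=
  let x := ncword cst m.2.1 * ncword env m.2.2 in if m.1 then - x else x.

Definition ncsum cst env s : T := foldr (fun m x => ncmono cst env m + x) 0 s.

Definition ncneg m : ncmonom := (~~ m.1, m.2).

Fixpoint ncinsert i w :=
  if w is j :: w' then if (i <= j)%N then i :: w else j :: ncinsert i w'
  else [:: i].

Definition ncmulm m m' : ncmonom :=
  (m.1 (+) m'.1, (foldr ncinsert m'.2.1 m.2.1, m.2.2 ++ m'.2.2)).

Fixpoint ncexpand e : seq ncmonom :=
  match e with
  | NCvar i => [:: (false, ([::], [:: i]))]
  | NCcst i => [:: (false, ([:: i], [::]))]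
  | NC0 => [::]
  | NC1 => [:: (false, ([::], [::]))]
  | NCadd a b => ncexpand a ++ ncexpand b
  | NCopp a => map ncneg (ncexpand a)
  | NCmul a b => let s := ncexpand b in
                 foldr (fun m r => map (ncmulm m) s ++ r) [::] (ncexpand a)
  end.

Fixpoint ncadd1 m s : seq ncmonom :=
  match s with
  | [::] => [:: m]
  | m' :: s' => if m' == ncneg m then s' else m' :: ncadd1 m s'
  end.

Definition nccancel s := foldr ncadd1 [::] s.

Fixpoint nccentral cst : Prop :=
  if cst is c :: cst' then (forall x, c * x = x * c) /\ nccentral cst' else True.

Section Central.
Variables cst env : seq T.
Hypothesis cstC : nccentral cst.

Lemma nccentral_nth i x : nth 0 cst i * x = x * nth 0 cst i.
Proof.
elim: cst cstC i => [|c l IH] /=; first by move=> _ i; rewrite nth_nil mul0r mulr0.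
by move=> [cC lC] [|i] //=; exact: IH.
Qed.

Lemma ncword_central w x : ncword cst w * x = x * ncword cst w.
Proof.
elim: w x => [|i w IH] x /=; first by rewrite mul1r mulr1.
by rewrite -mulrA IH !mulrA nccentral_nth.
Qed.

Lemma ncword_cat w w' : ncword env (w ++ w') = ncword env w * ncword env w'.
Proof. by elim: w => [|i w IH] /=; rewrite ?mul1r // IH mulrA. Qed.

Lemma ncword_insert i w : ncword cst (ncinsert i w) = nth 0 cst i * ncword cst w.
Proof.
elim: w => //= j w IH; case: ifP => //= _.
by rewrite IH !mulrA nccentral_nth.
Qed.

Lemma ncword_merge v w : ncword cst (foldr ncinsert w v) = ncword cst v * ncword cst w.
Proof. by elim: v => [|i v IH] /=; rewrite ?mul1r // ncword_insert IH mulrA. Qed.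

Lemma ncsum_cat s s' : ncsum cst env (s ++ s') = ncsum cst env s + ncsum cst env s'.
Proof. by elim: s => [|m s IH] /=; rewrite ?add0r // IH addrA. Qed.

Lemma ncmono_neg m : ncmono cst env (ncneg m) = - ncmono cst env m.
Proof. by case: m => [[] w]; rewrite /ncmono /= ?opprK. Qed.

Lemma ncmono_mul m m' :
  ncmono cst env (ncmulm m m') = ncmono cst env m * ncmono cst env m'.
Proof.
case: m m' => [b [v w]] [b' [v' w']]; rewrite /ncmono /= ncword_merge ncword_cat.
have -> : ncword cst v * ncword cst v' * (ncword env w * ncword env w')
        = ncword cst v * ncword env w * (ncword cst v' * ncword env w').
  by rewrite -!mulrA; congr (_ * _); rewrite !mulrA (ncword_central v').
by case: b; case: b'; rewrite /= ?mulrNN ?mulNr ?mulrN.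
Qed.

Lemma ncsum_mulm m s :
  ncsum cst env (map (ncmulm m) s) = ncmono cst env m * ncsum cst env s.
Proof.
by elim: s => [|m' s IH] /=; rewrite ?mulr0 // IH mulrDr ncmono_mul.
Qed.

Lemma ncsum_expand e : ncsum cst env (ncexpand e) = nceval cst env e.
Proof.
elim: e => [i|i|||a IHa b IHb|a IHa|a IHa b IHb] //=.
- by rewrite /ncmono /= mulr1 mul1r addr0.
- by rewrite /ncmono /= !mulr1 addr0.
- by rewrite /ncmono /= mulr1 addr0.
- by rewrite ncsum_cat IHa IHb.
- rewrite -IHa; elim: (ncexpand a) => [|m s IH] /=; first by rewrite oppr0.
  by rewrite IH ncmono_neg opprD.
- rewrite -IHa -IHb; elim: (ncexpand a) => [|m s IH] /=; first by rewrite mul0r.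
  by rewrite ncsum_cat IH ncsum_mulm mulrDl.
Qed.

Lemma ncsum_cancel s : ncsum cst env (nccancel s) = ncsum cst env s.
Proof.
elim: s => //= m s <-; elim: (nccancel s) => //= m' t IH.
case: eqP => [->|_]; first by rewrite ncmono_neg addrA subrr add0r.
by rewrite /= IH addrCA.
Qed.

(** Opposite monomials of the formal difference are cancelled one by one; if nothing
    remains, then the difference vanishes under every valuation. *)
Lemma nceval_eq e1 e2 :
  nilp (nccancel (ncexpand (NCadd e1 (NCopp e2)))) ->
  nceval cst env e1 = nceval cst env e2.
Proof.
move=> /nilP E; apply/eqP; rewrite -subr_eq0; apply/eqP.
by have := ncsum_cancel (ncexpand (NCadd e1 (NCopp e2)));
  rewrite E ncsum_expand.
Qed.
End Central.
End NCRing.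

Ltac nc_mem x l :=
  lazymatch l with
  | nil => constr:(false)
  | ?y :: ?l' =>
    match constr:(Set) with
    | _ => let _ := match constr:(Set) with _ => constr_eq x y end in constr:(true)
    | _ => nc_mem x l'
    end
  end.

Ltac nc_index x l :=
  lazymatch l with
  | ?y :: ?l' =>
    match constr:(Set) with
    | _ => let _ := match constr:(Set) with _ => constr_eq x y end in constr:(O)
    | _ => let n := nc_index x l' in constr:(S n)
    end
  end.

(** Recognition of central atoms, and the proof that they are central. Both are
    redefined once there are scalars. *)
Ltac nc_is_central t := constr:(false).
Ltac nc_prove_central := idtac.

(** The boolean [c] selects the central atoms or the other ones. *)
Ltac nc_atoms c t l :=
  lazymatch t with
  | (?a + ?b)%R => let l' := nc_atoms c a l in nc_atoms c b l'
  | (?a * ?b)%R => let l' := nc_atoms c a l in nc_atoms c b l'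
  | (- ?a)%R => nc_atoms c a l
  | 0%R => l
  | 1%R => l
  | _ =>
    let ct := nc_is_central t in
    lazymatch ct with
    | c => let i := nc_mem t l in
           lazymatch i with true => l | false => constr:(t :: l) end
    | _ => l
    end
  end.

Ltac nc_reify t cl l :=
  lazymatch t with
  | (?a + ?b)%R =>
    let x := nc_reify a cl l in let y := nc_reify b cl l in constr:(NCadd x y)
  | (?a * ?b)%R =>
    let x := nc_reify a cl l in let y := nc_reify b cl l in constr:(NCmul x y)
  | (- ?a)%R => let x := nc_reify a cl l in constr:(NCopp x)
  | 0%R => constr:(NC0)
  | 1%R => constr:(NC1)
  | _ =>
    let ct := nc_is_central t in
    lazymatch ct with
    | true => let n := nc_index t cl in constr:(NCcst n)
    | false => let n := nc_index t l in constr:(NCvar n)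
    end
  end.

(** [ncring] proves the identities that hold in all noncommutative rings, given the
    centrality of the atoms that [nc_is_central] recognizes. *)
Ltac ncring :=
  rewrite ?expr2;
  lazymatch goal with
  | |- @eq ?T ?a ?b =>
    let l0 := constr:(@nil T) in
    let l1 := nc_atoms false a l0 in
    let l := nc_atoms false b l1 in
    let c1 := nc_atoms true a l0 in
    let cl := nc_atoms true b c1 in
    let x := nc_reify a cl l in
    let y := nc_reify b cl l in
    refine (@nceval_eq _ cl l _ x y _);
    [nc_prove_central | vm_compute; exact isT]
  end.

(** * Positivity in C*-algebras *)

(** The structure of a C*-algebra that the arguments use, on a bare ring so that it
    applies both to [A] and to the matrices over [A]: the scalars are given by
    central elements, and completeness by Cauchy sequences. One inequality of the
    C*-identity implies the other. *)
Record cstar (R : realType) (T : pzRingType) := Cstar {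
  adj : T -> T;
  nrm : T -> R;
  sc : {rmorphism R -> T};
  im : T;
  adjK : involutive adj;
  adjD : {morph adj : x y / x + y};
  adjM : forall x y, adj (x * y) = adj y * adj x;
  adj_sc : forall r, adj (sc r) = sc r;
  scC : forall r x, sc r * x = x * sc r;
  im_sqr : im * im = - 1;
  imC : forall x, im * x = x * im;
  adj_im : adj im = - im;
  nrm_eq0 : forall x, nrm x = 0 -> x = 0;
  nrmD : forall x y, nrm (x + y) <= nrm x + nrm y;
  nrmM : forall x y, nrm (x * y) <= nrm x * nrm y;
  nrm_scM : forall r x, nrm (sc r * x) = `|r| * nrm x;
  nrm_adjM_ge : forall x, nrm x ^+ 2 <= nrm (adj x * x);
  nrm_complete : forall u : nat -> T,
    (forall e : R, 0 < e -> exists n0, forall m n, (n0 <= m)%N -> (n0 <= n)%N ->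
       nrm (u m - u n) < e) ->
    exists l, forall e : R, 0 < e -> exists n0, forall n, (n0 <= n)%N ->
       nrm (u n - l) < e }.

Ltac nc_is_central t ::=
  lazymatch t with @GRing.RMorphism.sort _ _ (sc _) _ => constr:(true) | _ => constr:(false) end.
Ltac nc_prove_central ::= repeat split; exact: scC.

Section CstarTheory.
Context (R : realType) (T : pzRingType) (C : cstar R T).
Local Notation N := (nrm C).
Local Notation "x ^†" := (adj C x) (at level 2, format "x ^†").
Local Notation s := (sc C).
Implicit Types (x y a b p q h k : T) (r t : R).

Lemma adj_zero : 0^† = 0.
Proof. by apply: (addrI (0^†)); rewrite -adjD !addr0. Qed.

Lemma adjN x : (- x)^† = - x^†.
Proof. by apply: (addrI (x^†)); rewrite -adjD !subrr adj_zero. Qed.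

Lemma adjB x y : (x - y)^† = x^† - y^†.
Proof. by rewrite adjD adjN. Qed.

Lemma adj_one : 1^† = 1.
Proof. by rewrite -[RHS](adjK C) -[in RHS](mulr1 (1^†)) adjM adjK mulr1. Qed.

Lemma adjX x n : (x ^+ n)^† = x^† ^+ n.
Proof. by elim: n => [|n IH]; rewrite ?adj_one // exprS adjM IH exprSr. Qed.

Lemma nrm0 : N 0 = 0.
Proof. by have := nrm_scM C 0 0; rewrite mulr0 normr0 mul0r. Qed.

Lemma nrmN x : N (- x) = N x.
Proof.
by have := nrm_scM C (-1) x; rewrite rmorphN rmorph1 mulN1r normrN normr1 mul1r.
Qed.

Lemma nrm_ge0 x : 0 <= N x.
Proof.
have : 0 <= N x + N (- x) by rewrite -nrm0 -[in leLHS](subrr x) nrmD.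
by rewrite nrmN; lra.
Qed.

Lemma nrmB x y : N (x - y) <= N x + N y.
Proof. by rewrite -[N y]nrmN nrmD. Qed.

(** From [N x ^+ 2 <= N (x^† * x) <= N x^† * N x]. *)
Lemma nrm_adj_le x : N x <= N (x^†).
Proof.
have := nrm_ge0 x; rewrite le_eqVlt => /orP[/eqP <-|x0]; first exact: nrm_ge0.
rewrite -(ler_pM2r x0) -expr2.
exact: le_trans (nrm_adjM_ge C x) (nrmM C _ _).
Qed.

Lemma nrm_adj x : N (x^†) = N x.
Proof.
apply/eqP; rewrite eq_le nrm_adj_le andbT.
by have := nrm_adj_le (x^†); rewrite adjK.
Qed.

Lemma nrm_adjM x : N (x^† * x) = N x ^+ 2.
Proof.
apply/eqP; rewrite eq_le nrm_adjM_ge andbT expr2.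
by rewrite -[X in _ <= X * _]nrm_adj nrmM.
Qed.

Lemma nrm1_le1 : N 1 <= 1.
Proof.
have := nrm_adjM 1; rewrite adj_one mulr1 => E.
have := nrm_ge0 1; rewrite le_eqVlt => /orP[/eqP <-//|x0].
by rewrite -(ler_pM2r x0) mul1r -expr2 -E.
Qed.

Lemma nrm_sc_le r : N (s r) <= `|r|.
Proof. by rewrite -[s r]mulr1 nrm_scM ler_piMr // nrm1_le1. Qed.

Lemma nrmX_le x n : N (x ^+ n.+1) <= N x ^+ n.+1.
Proof.
elim: n => [|n IH]; first by rewrite !expr1.
rewrite exprS [leRHS]exprS; apply: le_trans (nrmM C _ _) _.
by rewrite ler_wpM2l ?nrm_ge0.
Qed.

Lemma nrmXl_le x y n : N (x ^+ n * y) <= N x ^+ n * N y.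
Proof.
elim: n => [|n IH]; first by rewrite !expr0 !mul1r.
rewrite !exprS -!mulrA; apply: le_trans (nrmM C _ _) _.
by rewrite ler_wpM2l ?nrm_ge0.
Qed.

Lemma nrm_small x : (forall e : R, 0 < e -> N x < e) -> x = 0.
Proof.
move=> H; apply: (@nrm_eq0 _ _ C); apply/eqP; rewrite eq_le nrm_ge0 andbT.
by apply/unstable.ler_gtP => e /H /ltW.
Qed.

Lemma scD r t : s (r + t) = s r + s t. Proof. exact: rmorphD. Qed.

Lemma scB r t : s (r - t) = s r - s t. Proof. exact: rmorphB. Qed.

Lemma scM r t : s (r * t) = s r * s t. Proof. exact: rmorphM. Qed.

Lemma sc1 : s 1 = 1. Proof. exact: rmorph1. Qed.

Lemma sc0 : s 0 = 0. Proof. exact: rmorph0. Qed.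

Lemma sc_half : s 2^-1 + s 2^-1 = 1.
Proof. by rewrite -scD -sc1; congr (s _); lra. Qed.

Definition selfadj x := x^† = x.

Definition limto (u : nat -> T) l :=
  forall e : R, 0 < e -> exists n0, forall n, (n0 <= n)%N -> N (u n - l) < e.

Lemma limto_unique u l l' : limto u l -> limto u l' -> l = l'.
Proof.
move=> ul ul'; apply/eqP; rewrite -subr_eq0; apply/eqP; apply: nrm_small => e e0.
have [n1 H1] := ul _ (divr_gt0 e0 (ltr0Sn R 1)).
have [n2 H2] := ul' _ (divr_gt0 e0 (ltr0Sn R 1)).
have {}H1 := H1 _ (leq_maxl n1 n2); have {}H2 := H2 _ (leq_maxr n1 n2).
have -> : l - l' = (u (maxn n1 n2) - l') - (u (maxn n1 n2) - l) by ncring.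
apply: le_lt_trans (nrmB _ _) _.
by rewrite [e]splitr addrC ltrD.
Qed.

Lemma limto_lip (f : T -> T) u l c :
  (forall n, N (f (u n) - f l) <= c * N (u n - l)) ->
  limto u l -> limto (f \o u) (f l).
Proof.
move=> fl ul e e0; have c1 : 0 < `|c| + 1 by rewrite ltr_wpDl.
have [n0 H] := ul _ (divr_gt0 e0 c1); exists n0 => n /H {}H.
apply: le_lt_trans (fl n) _; move: H; rewrite ltr_pdivlMr // => H.
apply: le_lt_trans H; rewrite mulrC ler_wpM2l ?nrm_ge0 //.
by apply: le_trans (ler_norm c) _; rewrite lerDl.
Qed.

Section Sqrt.
Variable z : T.
Hypothesis z1 : N z <= 1.

(** If [q] is a fixed point of [q |-> (z + q^2) / 2], then [(1 - q)^2 = 1 - z]. The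
    real iteration [rqit] is the case [z = 1] and dominates all the others. *)
Fixpoint sqit n : T := if n is n'.+1 then s (2^-1) * (z + sqit n' ^+ 2) else 0.
Fixpoint rqit n : R := if n is n'.+1 then 2^-1 * (1 + rqit n' ^+ 2) else 0.

Lemma rqit_bnd n : 0 <= rqit n <= 1.
Proof.
elim: n => [|n /andP[a b]] /=; rewrite ?lexx ?ler01 //.
by have := mulr_ge0 a a; have := mulr_ile1 a a b b; rewrite expr2; lra.
Qed.

Lemma sqit_comm y n : z * y = y * z -> sqit n * y = y * sqit n.
Proof.
move=> zy; elim: n => [|n IH] /=; first by rewrite mul0r mulr0.
rewrite -mulrA [RHS]mulrA -scC -mulrA; congr (_ * _).
by rewrite mulrDl mulrDr zy expr2 -mulrA IH mulrA IH -mulrA.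
Qed.

Lemma sqit_bnd n : N (sqit n) <= rqit n.
Proof.
elim: n => [|n IH] /=; first by rewrite nrm0.
rewrite nrm_scM ger0_norm ?invr_ge0 // ler_wpM2l ?invr_ge0 //.
apply: le_trans (nrmD C _ _) (lerD z1 _).
apply: le_trans (nrmX_le _ 1) _.
by rewrite ler_pXn2r // ?nnegrE ?nrm_ge0 //; have /andP[] := rqit_bnd n.
Qed.

(** The iterates are polynomials in [z] with nonnegative coefficients, hence their
    differences are at most those of the real iteration. In the induction, this is
    the factorization of a difference of squares of commuting elements. *)
Lemma sqit_dist (k n : nat) : N (sqit (n + k) - sqit n) <= rqit (n + k) - rqit n.
Proof.
elim: n => [|n IH] /=; first by rewrite !subr0 add0n sqit_bnd.
set a := sqit (n + k); set b := sqit n in IH *.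
have ab : a * b = b * a.
  by rewrite sqit_comm //; apply/esym/sqit_comm.
have -> : s 2^-1 * (z + a ^+ 2) - s 2^-1 * (z + b ^+ 2)
        = s 2^-1 * ((a + b) * (a - b)).
  rewrite -mulrBr; congr (_ * _).
  have -> : (a + b) * (a - b) = (z + a ^+ 2) - (z + b ^+ 2) + (b * a - a * b)
    by ncring.
  by rewrite ab subrr addr0.
rewrite nrm_scM ger0_norm ?invr_ge0 //.
have := sqit_bnd (n + k); have := sqit_bnd n; rewrite -/a -/b => Hb Ha.
have /andP[c0 _] := rqit_bnd (n + k); have /andP[d0 _] := rqit_bnd n.
set c := rqit (n + k) in Ha c0 IH *; set d := rqit n in Hb d0 IH *.
have : N ((a + b) * (a - b)) <= (c + d) * (c - d).
  apply: le_trans (nrmM C _ _) _; apply: ler_pM; rewrite ?nrm_ge0 //.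
  by apply: le_trans (nrmD C _ _) (lerD _ _).
by nra.
Qed.

Lemma rqit_cauchy (e : R) : 0 < e -> exists n0, forall k n : nat, (n0 <= n)%N ->
  rqit (n + k) - rqit n < e.
Proof.
move=> e0.
have nd : nondecreasing_seq rqit.
  apply/nondecreasing_seqP; elim => [|n IH] /=.
    by rewrite expr0n addr0 mulr1 invr_ge0.
  have /andP[a0 _] := rqit_bnd n; have /andP[b0 _] := rqit_bnd n.+1.
  rewrite ler_wpM2l ?invr_ge0 // lerD2l ler_pXn2r ?nnegrE //.
have ub : has_ubound (range rqit).
  by exists 1 => _ [n _ <-]; have /andP[] := rqit_bnd n.
have := nondecreasing_cvgn nd ub.
move=> /cvgrPdist_lt /(_ _ e0) [n0 _ H].
exists n0 => k n n0n.
have := H n n0n; set S := sup _.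
have kS : rqit (n + k) <= S by apply: ub_le_sup => //; exists (n + k)%N.
by rewrite ltr_norml => /andP[_]; lra.
Qed.

Lemma sqrt_lim : exists q, [/\ q + q = z + q ^+ 2, N q <= 1 &
  limto sqit q].
Proof.
have [q qP] : exists q, limto sqit q.
  apply: nrm_complete => e e0.
  have [n0 H] := rqit_cauchy e0; exists n0.
  have aux m n : (n0 <= m)%N -> (m <= n)%N -> N (sqit n - sqit m) < e.
    move=> n0m mn; rewrite -(subnKC mn).
    exact: le_lt_trans (sqit_dist _ _) (H _ _ n0m).
  move=> m n n0m n0n; have [mn|/ltnW nm] := leqP m n.
    by rewrite -nrmN opprB aux.
  by rewrite aux.
exists q.
have q1 : N q <= 1.
  apply/unstable.ler_gtP => c c1; have := c1; rewrite -subr_gt0 => /qP [n /(_ _ (leqnn n)) H].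
  have -> : q = sqit n - (sqit n - q) by ncring.
  apply: le_trans (nrmB _ _) _.
  have /andP[_] := rqit_bnd n; have := sqit_bnd n; move/ltW: H; lra.
split=> //.
have l1 : limto (fun n => sqit n.+1) q.
  by move=> e /qP[n0 H]; exists n0 => n n0n; apply: H; rewrite ltnW.
have l2 : limto (fun n => sqit n.+1) (s 2^-1 * (z + q ^+ 2)).
  apply: (@limto_lip (fun x => s 2^-1 * (z + x ^+ 2)) sqit q 1) => // n.
  rewrite mul1r.
  rewrite -mulrBr nrm_scM ger0_norm ?invr_ge0 //.
  have -> : z + sqit n ^+ 2 - (z + q ^+ 2)
          = sqit n * (sqit n - q) + (sqit n - q) * q by ncring.
  have /andP[_ b1] := rqit_bnd n; have b2 := sqit_bnd n.
  have := nrmD C (sqit n * (sqit n - q)) ((sqit n - q) * q).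
  have := nrmM C (sqit n) (sqit n - q); have := nrmM C (sqit n - q) q.
  have := nrm_ge0 (sqit n - q); have := nrm_ge0 (sqit n); nra.
have {l1 l2} E := limto_unique l1 l2.
by rewrite [in LHS]E -mulrDl sc_half mul1r.
Qed.

Lemma sqit_adj n : selfadj z -> selfadj (sqit n).
Proof.
move=> zz; elim: n => [|n IH] /=; first exact: adj_zero.
by rewrite /selfadj adjM adjD adjX adj_sc zz IH scC.
Qed.

End Sqrt.

(** The root is [1 - q] for the limit [q] of the iteration started from [z = 1 - h];
    whatever commutes with [h] commutes with the iterates, hence with the limit. *)
Lemma sqrt_near1 h : selfadj h -> N (1 - h) <= 1 ->
  exists p, [/\ selfadj p, p * p = h, N (1 - p) <= 1 &
    forall y, h * y = y * h -> p * y = y * p].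
Proof.
move=> hh h1; have [q [qE q1 ql]] := sqrt_lim h1.
have hz : selfadj (1 - h) by rewrite /selfadj adjB adj_one hh.
exists (1 - q); split.
- rewrite /selfadj adjB adj_one; congr (_ - _).
  apply: limto_unique (ql) => e /ql [n0 H]; exists n0 => n /H.
  by rewrite -(nrm_adj (_ - q)) adjB sqit_adj.
- have -> : (1 - q) * (1 - q) = 1 + q ^+ 2 - (q + q) by ncring.
  by rewrite qE; ncring.
- by rewrite opprB addrC subrK.
move=> y hy.
have zy : (1 - h) * y = y * (1 - h) by rewrite mulrBl mulrBr hy mul1r mulr1.
suff : q * y - y * q = 0.
  by move/eqP; rewrite subr_eq0 mulrBl mulrBr mul1r mulr1 => /eqP ->.
set f := fun x => x * y - y * x.
apply: (@limto_unique (f \o sqit (1 - h))); last first.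
  by move=> e e0; exists 0%N => n _; rewrite /= /f sqit_comm // subrr subr0 nrm0.
apply: (limto_lip (c := 2 * N y) _ ql) => n; rewrite /f; set x := sqit _ n.
have -> : x * y - y * x - (q * y - y * q) = (x - q) * y - y * (x - q) by ncring.
have := nrmB ((x - q) * y) (y * (x - q)).
have := nrmM C (x - q) y; have := nrmM C y (x - q); lra.
Qed.

(** The element [u = p + i q] satisfies [u^† u = r] and [p] is its real part. This
    replaces the spectral radius in the whole theory. *)
Lemma circle_bound p q r : selfadj p -> selfadj q -> p * q = q * p ->
  p * p + q * q = s r -> N p ^+ 2 <= `|r|.
Proof.
move=> pp qq pq E; set u := p + im C * q.
have u_adj : u^† = p - im C * q.
  by rewrite /u adjD adjM adj_im pp qq mulrN imC.
have uu : u^† * u = s r.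
  rewrite u_adj -E /u.
  have -> : (p - im C * q) * (p + im C * q) = p * p + p * im C * q
     - im C * (q * p) - (im C * q) * im C * q by ncring.
  have -> : im C * q * im C = - q by rewrite -imC mulrA im_sqr mulN1r.
  by rewrite -pq -(imC C p); ncring.
have Nu : N u ^+ 2 <= `|r| by rewrite -nrm_adjM uu nrm_sc_le.
apply: le_trans Nu; rewrite ler_pXn2r ?nnegrE ?nrm_ge0 //.
have : N (s 2 * p) <= N u + N (u^†).
  have -> : s 2 * p = u + u^† by rewrite u_adj /u (scD 1 1) sc1; ncring.
  exact: nrmD.
by rewrite nrm_adj nrm_scM ger0_norm //; lra.
Qed.

(** The condition on the norm says that the spectrum of [h] lies in [[0, 2 t]]. *)
Definition Pos h := selfadj h /\ exists2 t, 0 <= t & N (s t - h) <= t.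

Lemma Pos_bound h t0 : Pos h -> exists t, t0 <= t /\ N (s t - h) <= t.
Proof.
case=> _ [t t0' H]; have [tt|tt] := leP t0 t; first by exists t.
exists t0; split=> //; have -> : s t0 - h = s (t0 - t) + (s t - h).
  by rewrite scB; ncring.
apply: le_trans (nrmD C _ _) _.
have t0t : 0 <= t0 - t by rewrite subr_ge0 ltW.
by have := nrm_sc_le (t0 - t); rewrite ger0_norm //; lra.
Qed.

Lemma selfadjD x y : selfadj x -> selfadj y -> selfadj (x + y).
Proof. by rewrite /selfadj adjD => -> ->. Qed.

Lemma selfadjN x : selfadj x -> selfadj (- x).
Proof. by rewrite /selfadj adjN => ->. Qed.

Lemma selfadjB x y : selfadj x -> selfadj y -> selfadj (x - y).
Proof. by move=> *; apply/selfadjD => //; apply/selfadjN. Qed.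

Lemma selfadj_sc r : selfadj (s r). Proof. exact: adj_sc. Qed.

Lemma selfadjM x y : selfadj x -> selfadj y -> x * y = y * x -> selfadj (x * y).
Proof. by rewrite /selfadj adjM => -> ->. Qed.

Lemma selfadj_adjM x : selfadj (x^† * x).
Proof. by rewrite /selfadj adjM adjK. Qed.

(** Scaling by [t^-1] reduces to an element at distance at most 1 from 1. *)
Lemma Pos_sqrt h : Pos h -> exists p, [/\ Pos p, p * p = h &
  forall y, h * y = y * h -> p * y = y * p].
Proof.
move=> Ph; have [t [t1 Ht]] := Pos_bound 1 Ph; have [hh _] := Ph.
have t0 : 0 < t by apply: lt_le_trans t1.
have ti0 : 0 <= t^-1 by rewrite invr_ge0 ltW.
have sa : selfadj (s t^-1 * h) by apply/selfadjM => //; [exact: adj_sc|exact: scC].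
have [] := @sqrt_near1 (s t^-1 * h) sa.
  have -> : 1 - s t^-1 * h = s t^-1 * (s t - h).
    by rewrite mulrBr -scM mulVf ?gt_eqF // sc1.
  rewrite nrm_scM ger0_norm //.
  by rewrite mulrC ler_pdivrMr // mul1r.
move=> p [pp pE p1 pc]; set c := Num.sqrt t.
have c0 : 0 <= c by rewrite sqrtr_ge0.
exists (s c * p); split.
- split; first by apply/selfadjM => //; [exact: adj_sc|exact: scC].
  exists c => //; have -> : s c - s c * p = s c * (1 - p) by ncring.
  by rewrite nrm_scM ger0_norm // ler_piMr.
- rewrite mulrA -[_ * s c]mulrA -[p * s c]scC !mulrA -scM -expr2 sqr_sqrtr ?(ltW t0) //.
  by rewrite -mulrA pE mulrA -scM mulfV ?gt_eqF // sc1 mul1r.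
- move=> y hy; rewrite -mulrA [y * _]mulrA -scC -mulrA pc //.
  by rewrite -mulrA hy mulrA scC mulrA.
Qed.

Lemma PosD h k : Pos h -> Pos k -> Pos (h + k).
Proof.
move=> [hh [t t0 Ht]] [kk [r r0 Hr]]; split; first exact: selfadjD.
exists (t + r); first exact: addr_ge0.
have -> : s (t + r) - (h + k) = (s t - h) + (s r - k) by rewrite scD; ncring.
by apply: le_trans (nrmD C _ _) (lerD _ _).
Qed.

Lemma sc_sub_Pos b r : selfadj b -> N b <= r -> Pos (s r - b).
Proof.
move=> bb br; split; first exact: selfadjB (selfadj_sc _) bb.
by exists r; [exact: le_trans (nrm_ge0 b) br | rewrite subKr].
Qed.

(** For [t = N (p p)], let [q] be a square root of [t - p p]; the bound of [q] on the
    circle [p p + q q = t] says that [N (t - p p) <= t]. *)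
Lemma sqr_Pos p : selfadj p -> Pos (p * p).
Proof.
move=> pp; have sp : selfadj (p * p) by apply: selfadjM.
set t := N (p * p).
have [q [[qq _] qE qc]] := Pos_sqrt (sc_sub_Pos sp (lexx t)).
have qp : q * p = p * q.
  by apply: qc; rewrite mulrBl mulrBr scC mulrA.
split=> //; exists t; first exact: nrm_ge0.
rewrite -qE -{1}qq nrm_adjM -[leRHS]ger0_norm ?nrm_ge0 //.
by apply: (@circle_bound _ p) => //; rewrite qE subrK.
Qed.

Lemma Pos0 : Pos 0.
Proof. by rewrite -(mulr0 0); apply: sqr_Pos; exact: adj_zero. Qed.

Lemma Pos_sc r : 0 <= r -> Pos (s r).
Proof.
move=> r0; rewrite -(sqr_sqrtr r0) expr2 scM; apply: sqr_Pos; exact: adj_sc.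
Qed.

Lemma Pos_comm_mul a b : Pos a -> Pos b -> a * b = b * a -> Pos (a * b).
Proof.
move=> /Pos_sqrt[p [[pp _] pE pc]] /Pos_sqrt[q [[qq _] qE qc]] ab.
have pq : p * q = q * p.
  by apply: pc; apply/esym/qc; rewrite ab.
have -> : a * b = (p * q) * (p * q).
  have -> : a * b = p * q * (p * q) + p * (p * q - q * p) * q.
    by rewrite -pE -qE; ncring.
  by rewrite pq subrr mulr0 mul0r addr0.
by apply: sqr_Pos; apply: selfadjM.
Qed.

(** Square roots of [h] and of [r - h] commute and lie on a circle. *)
Lemma Pos_nrm_le h r : 0 <= r -> Pos h -> Pos (s r - h) -> N h <= r.
Proof.
move=> r0 /Pos_sqrt[p [[pp _] pE pc]] /Pos_sqrt[q [[qq _] qE qc]].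
have qp : q * p = p * q.
  apply: qc; rewrite mulrBl mulrBr scC; congr (_ - _); apply/esym/pc => //.
rewrite -pE -{1}pp nrm_adjM -[leRHS]ger0_norm //.
by apply: (@circle_bound _ q) => //; rewrite pE qE addrC subrK.
Qed.

Lemma Pos_nrm_mono a b : Pos a -> Pos (b - a) -> N a <= N b.
Proof.
move=> Pa Pba; have sb : selfadj b.
  by rewrite -(subrK a b); apply: selfadjD; [case: Pba|case: Pa].
apply: Pos_nrm_le => //; first exact: nrm_ge0.
have -> : s (N b) - a = (s (N b) - b) + (b - a) by ncring.
by apply: PosD => //; exact: sc_sub_Pos.
Qed.

(** Bernoulli's inequality [(1 + k)^n >= 1 + n k], multiplied by [k]. *)
Lemma Pos_bernoulli k n : Pos k ->
  Pos (k * (1 + k) ^+ n - (k + s n%:R * (k * k))).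
Proof.
move=> Pk; elim: n => [|n IH].
  have -> : k * (1 + k) ^+ 0 - (k + s 0 * (k * k)) = 0.
    by rewrite expr0 sc0; ncring.
  exact: Pos0.
set b := 1 + k; set D := _ - _ in IH.
have bk : b * k = k * b by rewrite /b; ncring.
have bX m : b * b ^+ m = b ^+ m * b by rewrite -exprS exprSr.
have -> : k * b ^+ n.+1 - (k + s n.+1%:R * (k * k))
        = D * b + s n%:R * (k * (k * k)).
  rewrite exprSr /D -/b -natr1 scD sc1 /b; ncring.
apply: PosD.
  apply: Pos_comm_mul => //.
    by apply: PosD => //; rewrite -sc1; apply: Pos_sc.
  rewrite /D mulrBl mulrBr; congr (_ - _).
    by rewrite -mulrA -bX !mulrA bk.
  have -> : b * (k + s n%:R * (k * k)) = (k + s n%:R * (k * k)) * b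
      + (k * s n%:R - s n%:R * k) * (k * k) by rewrite /b; ncring.
  by rewrite (scC C n%:R k) subrr mul0r addr0.
apply: Pos_comm_mul; [exact: Pos_sc | | exact: scC].
apply: Pos_comm_mul => //; last by rewrite mulrA.
by apply: Pos_comm_mul.
Qed.

Lemma natr_mul_bounded r t : 0 <= r -> (forall n, n%:R * r <= t) -> r = 0.
Proof.
move=> r0 H; apply/eqP; rewrite eq_le r0 andbT leNgt; apply/negP => r1.
have := H (Num.truncn (t / r)).+1; rewrite leNgt => /negP; apply.
by rewrite -ltr_pdivrMr // truncnS_gt.
Qed.

(** If [y^† y] is negative and [y y^†] is positive, then with [k = g^2 / t] and the
    contraction [a = 1 - y y^† / t] one has [a y = y (1 + k)]. Hence
    [k (1 + k)^n = - y^† a^n y / t] is bounded in [n], whereas it dominates [n k^2]. *)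
Lemma adjM_neg_sqr y g : selfadj g -> y^† * y = - (g * g) -> Pos (y * y^†) ->
  y = 0.
Proof.
move=> gg yE Py; have [t [t1 Ht]] := Pos_bound 1 Py.
have t0 : 0 < t by apply: lt_le_trans t1.
have ti0 : 0 <= t^-1 by rewrite invr_ge0 ltW.
set k := s t^-1 * (g * g); set a := 1 - s t^-1 * (y * y^†).
have Pk : Pos k.
  by apply: Pos_comm_mul; [apply: Pos_sc; rewrite invr_ge0 ltW
                          |exact: sqr_Pos|exact: scC].
have kE : k = - (s t^-1 * (y^† * y)) by rewrite yE mulrN opprK.
have a1 : N a <= 1.
  have -> : a = s t^-1 * (s t - y * y^†).
    by rewrite mulrBr -scM mulVf ?gt_eqF // sc1.
  rewrite nrm_scM ger0_norm //.
  by rewrite mulrC ler_pdivrMr // mul1r.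
have ay : a * y = y * (1 + k).
  rewrite kE /a mulrBl mulrBr mulr1 mul1r; congr (_ - _).
  by rewrite [RHS]mulrA -scC !mulrA.
have aX n : a ^+ n * y = y * (1 + k) ^+ n.
  elim: n => [|n IH]; first by rewrite !expr0 mul1r mulr1.
  by rewrite exprSr -mulrA ay mulrA IH -mulrA -exprSr.
have bound n : N (k * (1 + k) ^+ n) <= t^-1 * N y ^+ 2.
  rewrite {1}kE mulNr nrmN -!mulrA -aX nrm_scM ger0_norm //.
  rewrite ler_wpM2l //.
  apply: le_trans (nrmM C _ _) _; rewrite nrm_adj expr2 ler_wpM2l ?nrm_ge0 //.
  apply: le_trans (nrmXl_le _ _ _) _; rewrite ler_piMl ?nrm_ge0 //.
  by rewrite exprn_ile1 ?nrm_ge0.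
have Pkk : Pos (k * k) by apply: sqr_Pos; case: Pk.
have kk0 : k * k = 0.
  apply: (@nrm_eq0 _ _ C); apply: (@natr_mul_bounded _ (t^-1 * N y ^+ 2)); first exact: nrm_ge0.
  move=> n; apply: le_trans (bound n).
  rewrite -[n%:R]ger0_norm // -nrm_scM; apply: Pos_nrm_mono.
    by apply: Pos_comm_mul => //; [exact: Pos_sc|exact: scC].
  have -> : k * (1 + k) ^+ n - s n%:R * (k * k)
    = k * (1 + k) ^+ n - (k + s n%:R * (k * k)) + k by ncring.
  by apply: PosD => //; exact: Pos_bernoulli.
have k0 : k = 0.
  apply: (@nrm_eq0 _ _ C); apply/eqP.
  by rewrite -sqrf_eq0 -nrm_adjM (proj1 Pk) kk0 nrm0.
apply: (@nrm_eq0 _ _ C); apply/eqP; rewrite -sqrf_eq0 -nrm_adjM.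
have -> : y^† * y = - (s t * k).
  by rewrite kE mulrN opprK mulrA -scM mulfV ?gt_eqF // sc1 mul1r.
by rewrite k0 mulr0 oppr0 nrm0.
Qed.

(** The sum is [2 (a^2 + b^2)] for the real part [a] and the imaginary part [b]. *)
Lemma adjM_add_Pos y : exists2 v, Pos v & y^† * y + y * y^† = v.
Proof.
set c := s 2^-1; set a := c * (y + y^†); set b := im C * (c * (y - y^†)).
have cE : c + c = 1 by exact: sc_half.
have cC x : c * x = x * c by exact: scC.
have sa : selfadj a.
  by rewrite /a /selfadj adjM adjD adjK adj_sc -cC addrC.
have sb : selfadj b.
  by rewrite /b /selfadj !adjM adj_sc adj_im adjB adjK -cC mulrN -imC -mulrN
     -mulrN opprB.
exists (a * a + a * a + (b * b + b * b)).
  by apply: PosD; apply: PosD; apply: sqr_Pos.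
have bb : b * b = - (c * (y - y^†) * (c * (y - y^†))).
  by rewrite {2}/b imC /b mulrA -[im C * _ * _]mulrA -imC !mulrA im_sqr !mulN1r !mulNr.
have aE x : c * x * (c * x) + c * x * (c * x) = c * (x * x).
  by rewrite -!mulrDl cE mul1r mulrA -cC mulrA.
rewrite bb -opprD !aE -mulrBr.
have -> : (y + y^†) * (y + y^†) - (y - y^†) * (y - y^†)
  = (y^† * y + y * y^†) + (y^† * y + y * y^†) by ncring.
by rewrite mulrDr -mulrDl cE mul1r.
Qed.

(** Let [m = |h|] be the root of [h^2] and [f = m - h], twice the negative part of
    [h = x^† x]. Then [y = x f] satisfies [y^† y = - m f^2], the opposite of a square,
    and by [adjM_add_Pos] this makes [y y^†] positive. So [y = 0], which forces
    [f = 0] and [h = m]. *)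
Theorem adjM_Pos x : Pos (x^† * x).
Proof.
set h := x^† * x; have hh : selfadj h by exact: selfadj_adjM.
have [m [Pm mE mc]] := Pos_sqrt (sqr_Pos hh).
have hm : m * h = h * m by apply: mc; rewrite mulrA.
have [r [[rr _] rE rc]] := Pos_sqrt Pm.
have mm : selfadj m by case: Pm.
have rh : r * h = h * r by apply: rc.
have rm : r * m = m * r by rewrite -rE mulrA.
set f := m - h; have ff : selfadj f by exact: selfadjB.
have rf : r * f = f * r by rewrite /f mulrBl mulrBr rm rh.
have hf : h * f = - (m * f).
  by rewrite /f mulrBr mulrBr -mE hm opprB.
have mf : m * f = f * m by rewrite /f mulrBl mulrBr hm.
have yE : (x * f)^† * (x * f) = - ((r * f) * (r * f)).
  rewrite adjM ff -mulrA [x^† * _]mulrA -/h hf mulrN; congr (- _).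
  by rewrite {1}rf -mulrA [r * (r * f)]mulrA rE.
have srf : selfadj (r * f) by exact: selfadjM.
have y0 : x * f = 0.
  apply: (adjM_neg_sqr srf yE).
  have [v Pv] := adjM_add_Pos (x * f); rewrite yE => vE.
  have -> : x * f * (x * f)^† = v + (r * f) * (r * f) by rewrite -vE; ncring.
  by apply: PosD => //; exact: sqr_Pos.
have hf0 : h * f = 0 by rewrite /h -mulrA y0 mulr0.
have ff0 : f * f = 0.
  by rewrite {1}/f mulrBl hf0 subr0; apply/eqP; rewrite -oppr_eq0 -hf hf0.
have f0 : f = 0.
  apply: (@nrm_eq0 _ _ C); apply/eqP; rewrite -sqrf_eq0 -nrm_adjM ff ff0.
  by rewrite nrm0.
by move/eqP: f0; rewrite subr_eq0 => /eqP <-.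
Qed.

(** The right-hand side makes sense in every ring with involution, and so is easy to
    check for sums and compressions, and is preserved by star homomorphisms. *)
Lemma contractionP a : N a <= 1 <-> exists k, 1 - a^† * a = k^† * k.
Proof.
split=> [a1|[k kE]].
  have : Pos (s 1 - a^† * a).
    apply: sc_sub_Pos; first exact: selfadj_adjM.
    by rewrite nrm_adjM exprn_ile1 ?nrm_ge0.
  by rewrite sc1 => /Pos_sqrt[p [[pp _] pE _]]; exists p; rewrite pp.
rewrite -(@expr_le1 _ 2) ?nrm_ge0 // -nrm_adjM.
apply: Pos_nrm_le => //; first exact: adjM_Pos.
by rewrite sc1 kE; exact: adjM_Pos.
Qed.

End CstarTheory.

(** * The unitary of a balanced pair *)

Section BalancedAlgebra.
Context (R : realType) (T : pzRingType) (C : cstar R T).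
Local Notation "x ^†" := (adj C x) (at level 2, format "x ^†").
Implicit Types a b : T.

Definition relR1 a b :=
  [/\ a^† * a = b^† * b, a * a^† = b * b^†,
      a * (1 - a^† * a) = b * (1 - b^† * b) &
      (1 - a * a^†) * a = (1 - b * b^†) * b].

Definition relR2 a b := forall c,
  c \in [:: 1 - a^† * a; 1 - a * a^†; 1 - b^† * b; 1 - b * b^†] ->
  (a - b) * c = 0 /\ (a^† - b^†) * c = 0.

Lemma selfadj_cube_eq0 h : selfadj C h -> h * h * h = 0 -> h = 0.
Proof.
have sq x : x^† * x = 0 -> x = 0.
  move=> E; apply: (@nrm_eq0 _ _ C); apply/eqP.
  by rewrite -sqrf_eq0 -nrm_adjM E nrm0.
move=> hh h3; apply: (sq); rewrite hh; apply: sq.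
by rewrite adjM hh mulrA h3 mul0r.
Qed.

(** The difference [h = a^† a - b^† b] is annihilated by [a - b] on both sides, while
    [h = a^† (a - b) + (a - b)^† b]; hence [h^3 = 0]. *)
Lemma relR2_adjM a b : relR2 a b -> a^† * a = b^† * b.
Proof.
move=> H; set h := a^† * a - b^† * b.
have [d1 e1] := H (1 - a^† * a) ltac:(by rewrite !inE eqxx).
have [d2 e2] := H (1 - b^† * b) ltac:(by rewrite !inE eqxx !orbT).
have hE : h = (1 - b^† * b) - (1 - a^† * a) by rewrite /h; ncring.
have dh : (a - b) * h = 0 by rewrite hE mulrBr d1 d2 subrr.
have eh : (a^† - b^†) * h = 0 by rewrite hE mulrBr e1 e2 subrr.
have hh : selfadj C h by apply: selfadjB; exact: selfadj_adjM.
have hd : h * (a - b)^† = 0 by rewrite -{1}hh -adjM dh adj_zero.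
have h2 : h * h = h * a^† * (a - b).
  have hE2 x : x * h = x * a^† * (a - b) + x * (a^† - b^†) * b.
    by rewrite /h; ncring.
  by rewrite hE2 -adjB hd mul0r addr0.
suff /eqP : h = 0 by rewrite subr_eq0 => /eqP.
by apply: selfadj_cube_eq0 => //; rewrite h2 -mulrA dh mulr0.
Qed.

Lemma relR2_adj a b : relR2 a b -> relR2 (a^†) (b^†).
Proof.
move=> H c; rewrite !inE !adjK => cP.
have [] : (a - b) * c = 0 /\ (a^† - b^†) * c = 0.
  by apply: H; rewrite !inE; case/or4P: cP => ->; rewrite ?orbT.
by [].
Qed.

(** Since [a^† a = b^† b] and, by symmetry, [a a^† = b b^†], the other relations in
    [relR1] say that [(a - b) c = 0] for [c = 1 - a^† a] and [(a - b)^† c = 0] for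
    [c = 1 - a a^†]. *)
Lemma relR2_relR1 a b : relR2 a b -> relR1 a b.
Proof.
move=> H; have E1 := relR2_adjM H.
have E2 : a * a^† = b * b^†.
  by have := relR2_adjM (relR2_adj H); rewrite !adjK.
have [d1 _] := H (1 - a^† * a) ltac:(by rewrite !inE eqxx).
have [_ e2] := H (1 - a * a^†) ltac:(by rewrite !inE eqxx !orbT).
split=> //.
  by apply/eqP; rewrite -subr_eq0 -E1 -mulrBl d1.
apply/eqP; rewrite -subr_eq0 -E2 -mulrBr.
have <- : ((a^† - b^†) * (1 - a * a^†))^† = (1 - a * a^†) * (a - b).
  by rewrite adjM !adjB adjM !adjK adj_one.
by rewrite e2 adj_zero.
Qed.

(** This is [1 - a a^† + a b^†], the upper left corner of the product of the unitary
    2 by 2 dilation of [a] with the adjoint of that of [b]. For a balanced pair the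
    off-diagonal corners of the product vanish, so that this corner is unitary. *)
Definition bal_unit a b := 1 - a * (a - b)^†.

Section R1.
Variables (a b : T).
Hypothesis Rab : relR1 a b.

Let d := a - b.

Lemma relR1_subl : (a - b) * (a^† * a) = a - b.
Proof.
case: Rab => E1 _ E3 _; rewrite mulrBl {2}E1; move: E3.
rewrite !mulrBr !mulr1 => E3.
have -> : a * (a^† * a) = a - (a - a * (a^† * a)) by rewrite subKr.
by rewrite E3; ncring.
Qed.

Lemma relR1_subr : (a * a^†) * (a - b) = a - b.
Proof.
case: Rab => _ E2 _ E4; rewrite mulrBr {2}E2; move: E4.
rewrite !mulrBl !mul1r => E4.
have -> : a * a^† * a = a - (a - a * a^† * a) by rewrite subKr.
by rewrite E4; ncring.
Qed.

Lemma relR1_sub_adjl : d^† * (a * a^†) = d^†.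
Proof. by rewrite /d -[in RHS]relR1_subr !adjM adjK. Qed.

Lemma bal_unitVr : bal_unit a b * (bal_unit a b)^† = 1.
Proof.
rewrite /bal_unit -/d [(1 - _)^†]adjB adj_one adjM adjK.
have dd : d^† * d = a^† * d + d^† * a.
  case: Rab => E1 _ _ _; rewrite /d adjB.
  have -> : (a^† - b^†) * (a - b) = a^† * a - a^† * b - b^† * a + b^† * b by ncring.
  by rewrite -E1; ncring.
have -> : (1 - a * d^†) * (1 - d * a^†)
   = 1 - a * d^† - d * a^† + a * (d^† * d) * a^† by ncring.
have -> : a * (d^† * d) * a^† = (a * a^† * d) * a^† + a * (d^† * (a * a^†)).
  by rewrite dd; ncring.
by rewrite relR1_sub_adjl relR1_subr -/d; ncring.
Qed.

Lemma bal_unitVl : (bal_unit a b)^† * bal_unit a b = 1.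
Proof.
rewrite /bal_unit -/d [(1 - _)^†]adjB adj_one adjM adjK.
have dd : d * d^† = a * d^† + d * a^†.
  case: Rab => _ E2 _ _; rewrite /d adjB.
  have -> : (a - b) * (a^† - b^†) = a * a^† - a * b^† - b * a^† + b * b^† by ncring.
  by rewrite -E2; ncring.
have -> : (1 - d * a^†) * (1 - a * d^†)
   = 1 - d * a^† - a * d^† + d * (a^† * a) * d^† by ncring.
by rewrite relR1_subl -/d dd; ncring.
Qed.

(** Together with [bal_unit_defect] this describes balanced pairs: [a] is obtained
    from [b] by a unitary that acts trivially on the defect of [b]. *)
Lemma bal_unit_mul : bal_unit a b * b = a.
Proof.
case: Rab => E1 _ _ _; rewrite /bal_unit adjB.
have -> : (1 - a * (a^† - b^†)) * b = b - a * a^† * b + a * (b^† * b) by ncring.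
rewrite -E1.
have -> : b - a * a^† * b + a * (a^† * a) = b + a * a^† * (a - b) by ncring.
by rewrite relR1_subr; ncring.
Qed.

Lemma bal_unit_adj_mul : (bal_unit a b)^† * a = b.
Proof. by rewrite -{2}bal_unit_mul mulrA bal_unitVl mul1r. Qed.

Lemma bal_unit_defect : (1 - a * a^†) * bal_unit a b = 1 - a * a^†.
Proof.
rewrite /bal_unit mulrBr mulr1.
have -> : (1 - a * a^†) * (a * (a - b)^†)
       = a * ((a - b)^† - a^† * a * (a - b)^†) by ncring.
have -> : a^† * a * (a - b)^† = (a - b)^†.
  by rewrite -[in RHS]relR1_subl !adjM adjK.
by rewrite subrr mulr0 subr0.
Qed.

End R1.

Lemma relR1_unitary u : u^† * u = 1 -> u * u^† = 1 -> relR1 u 1.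
Proof.
by move=> u1 u2; rewrite /relR1 adj_one !mulr1 u1 u2 !subrr !mulr0 mul0r.
Qed.

End BalancedAlgebra.

(** * Families of balanced pairs *)

Section Corners.
Context (R : realType) (T : pzRingType) (C : cstar R T).
Local Notation "x ^†" := (adj C x) (at level 2, format "x ^†").
Local Notation N := (nrm C).
Local Notation s := (sc C).
Implicit Types a b e v : T.

Lemma contraction_Pos a : N a <= 1 <-> Pos C (1 - a^† * a).
Proof.
rewrite contractionP; split=> [[k ->]|]; first exact: adjM_Pos.
by move=> /Pos_sqrt[k [[kk _] kE _]]; exists k; rewrite kk.
Qed.

Lemma contraction_Pos_adj a : N a <= 1 <-> Pos C (1 - a * a^†).
Proof. by rewrite -nrm_adj contraction_Pos adjK. Qed.

Lemma unitary_contraction u : u^† * u = 1 -> N u <= 1.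
Proof. by move=> E; apply/contraction_Pos; rewrite E subrr; exact: Pos0. Qed.

Definition balR1 a b := [/\ N a <= 1, N b <= 1 & relR1 C a b].

(** The third relation follows from the fourth, as [x (1 - x^† x) = (1 - x x^†) x]. *)
Lemma relR1_intro a b : a^† * a = b^† * b -> a * a^† = b * b^† ->
  (1 - a * a^†) * a = (1 - b * b^†) * b -> relR1 C a b.
Proof.
move=> E1 E2 E4; split=> //.
have sw x : x * (1 - x^† * x) = (1 - x * x^†) * x by ncring.
by rewrite !sw.
Qed.

Section Rotation.
Variables a b e v : T.
Hypothesis Bab : balR1 a b.
Hypothesis (ee : e^† = e).
Hypothesis (ea : e * a = a) (ae : a * e = a) (eb : e * b = b) (be : b * e = b).
Hypothesis (vv : v * v^† = e) (ve : v * e = 0) (ev : e * v = v).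
Variables p q : R.
Hypothesis pq : p * p + q * q = 1.
Let w := bal_unit C a b.

Let Rab : relR1 C a b. Proof. by case: Bab. Qed.

Lemma support_idem : e * e = e.
Proof. by rewrite -{2}vv mulrA ev vv. Qed.

Lemma bal_unit_comm : e * w = w * e.
Proof.
have de : (a - b)^† * e = (a - b)^† by rewrite -[X in _ * X]ee -adjM mulrBr ea eb.
by rewrite /w /bal_unit mulrBr mulrBl mulr1 mul1r mulrA ea -mulrA de.
Qed.

(** The unitary [w] differs from 1 only inside the support [e]. *)
Lemma bal_unit_off : w * (1 - e) = 1 - e.
Proof.
rewrite /w /bal_unit adjB.
have a0 : a^† * (1 - e) = 0 by rewrite mulrBr mulr1 -[X in _ * X]ee -adjM ea subrr.
have b0 : b^† * (1 - e) = 0 by rewrite mulrBr mulr1 -[X in _ * X]ee -adjM eb subrr.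
have -> : (1 - a * (a^† - b^†)) * (1 - e)
  = 1 - e - a * (a^† * (1 - e) - b^† * (1 - e)) by ncring.
by rewrite a0 b0 subrr mulr0 subr0.
Qed.

Let x := s p * a + s q * (w * v).
Let y := s p * b + s q * v.

Let xa : x^† = a^† * s p + v^† * w^† * s q.
Proof. by rewrite /x adjD !adjM !adj_sc. Qed.
Let ya : y^† = b^† * s p + v^† * s q.
Proof. by rewrite /y adjD !adjM !adj_sc. Qed.

Let va : v * a^† = 0.
Proof. by rewrite -(ae) adjM ee mulrA ve mul0r. Qed.
Let vb : v * b^† = 0.
Proof. by rewrite -(be) adjM ee mulrA ve mul0r. Qed.
Let av : a * v^† = 0.
Proof. by apply: (can_inj (adjK C)); rewrite adjM adjK va adj_zero. Qed.
Let bv : b * v^† = 0.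
Proof. by apply: (can_inj (adjK C)); rewrite adjM adjK vb adj_zero. Qed.

Let xx : x * x^† = s p * s p * (a * a^†) + s q * s q * e.
Proof.
have -> : x * x^† = s p * s p * (a * a^†) + s q * s q * (w * (v * v^†) * w^†)
   + s p * s q * (a * v^† * w^† + w * (v * a^†)) by rewrite xa /x; ncring.
rewrite va av vv -bal_unit_comm -[e * w * _]mulrA bal_unitVr //.
by rewrite mulr1 mul0r mulr0 addr0 mulr0 addr0.
Qed.
Let yy : y * y^† = s p * s p * (b * b^†) + s q * s q * e.
Proof.
have -> : y * y^† = s p * s p * (b * b^†) + s q * s q * (v * v^†)
   + s p * s q * (b * v^† + v * b^†) by rewrite ya /y; ncring.
by rewrite vb bv vv addr0 mulr0 addr0.
Qed.

Let spq : s p * s p + s q * s q = 1.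
Proof. by rewrite -!scM -scD pq sc1. Qed.

(** Here [x = w y], and [y y^† = p^2 b b^† + q^2 e], so that the defect of [y] in [e] is
    [p^2] times that of [b], on which [w] acts trivially. *)
Lemma rotation_balR1 : balR1 x y.
Proof.
have P1 z : e * z = z -> z * e = z -> N z <= 1 ->
    Pos C (1 - (s p * s p * (z * z^†) + s q * s q * e)).
  move=> ez ze /contraction_Pos_adj/Pos_sqrt[k [[kk _] kE _]].
  have eze : e * (1 - z * z^†) * e = e - z * z^†.
    have z'e : z^† * e = z^† by rewrite -[X in _ * X]ee -adjM ez.
    by rewrite mulrBr mulrBl mulr1 support_idem mulrA ez -mulrA z'e.
  have -> : 1 - (s p * s p * (z * z^†) + s q * s q * e)
     = (1 - (s p * s p + s q * s q) * e) + s p * s p * (e - z * z^†) by ncring.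
  rewrite spq mul1r -eze -kE.
  have -> : 1 - e = (1 - e)^† * (1 - e).
    rewrite adjB adj_one ee.
    have -> : (1 - e) * (1 - e) = 1 - e - e + e * e by ncring.
    by rewrite support_idem subrK.
  have -> : s p * s p * (e * (k * k) * e) = (s p * (k * e))^† * (s p * (k * e)).
    by rewrite !adjM ee adj_sc kk; ncring.
  by apply: PosD; exact: adjM_Pos.
case: Bab => Na Nb [E1 E2 E3 E4].
split.
- by apply/contraction_Pos_adj; rewrite xx; exact: P1.
- by apply/contraction_Pos_adj; rewrite yy; exact: P1.
apply: relR1_intro.
- have -> : x^† * x = s p * s p * (a^† * a) + s q * s q * (v^† * (w^† * w) * v)
     + s p * s q * ((w^† * a)^† * v + v^† * (w^† * a)).
    by rewrite xa /x [(w^† * a)^†]adjM adjK; ncring.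
  have -> : y^† * y = s p * s p * (b^† * b) + s q * s q * (v^† * v)
     + s p * s q * (b^† * v + v^† * b) by rewrite ya /y; ncring.
  by rewrite bal_unit_adj_mul // bal_unitVl // mulr1 E1.
- by rewrite xx yy E2.
have aux z t : e * t = t -> e * z = z ->
   (1 - (s p * s p * (b * b^†) + s q * s q * e)) * (s p * z + s q * t)
   = s p * s p * (s p * ((1 - b * b^†) * z) + s q * ((1 - b * b^†) * t)).
  move=> et ez.
  have -> : (1 - (s p * s p * (b * b^†) + s q * s q * e)) * (s p * z + s q * t)
   = (s p * z + s q * t) - s q * s q * (s p * (e * z) + s q * (e * t))
     - s p * s p * (b * b^†) * (s p * z + s q * t) by ncring.
  rewrite et ez.
  by rewrite -[X in X - _ - _]mul1r -{1}spq; ncring.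
rewrite xx yy E2 !aux //; last by rewrite mulrA bal_unit_comm -mulrA ev.
congr (_ * (_ * _ + _ * _)).
  by rewrite -[in LHS]E2 E4.
rewrite mulrA -[in LHS]E2 bal_unit_defect // E2 //.
Qed.

End Rotation.

(** Both elements have the absolute value [e + t (1 - e)], and they coincide on [1 - e]. *)
Lemma filling_balR1 u e t : u^† * u = 1 -> u * u^† = 1 -> e^† = e -> e * e = e ->
  e * u = u * e -> 0 <= t <= 1 ->
  balR1 (u * e + s t * (1 - e)) (e + s t * (1 - e)).
Proof.
move=> u1 u2 ee e2 eu /andP[t0 t1]; set f := 1 - e.
have ff : f^† = f by rewrite /f adjB adj_one ee.
have f2 : f * f = f.
  by rewrite /f; have -> : (1 - e) * (1 - e) = 1 - e - (e - e * e) by [ncring];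
     rewrite e2 subrr subr0.
have ef : e * f = 0 by rewrite /f mulrBr mulr1 e2 subrr.
have fe : f * e = 0 by rewrite /f mulrBl mul1r e2 subrr.
have ue : e * u^† = u^† * e.
  by apply: (can_inj (adjK C)); rewrite !adjM adjK ee.
have uf : f * u = u * f by rewrite /f mulrBr mulrBl mulr1 mul1r eu.
set x := u * e + s t * f; set y := e + s t * f.
have xa : x^† = e * u^† + f * s t by rewrite /x adjD !adjM adj_sc ee ff.
have ya : y^† = e + f * s t by rewrite /y adjD adjM adj_sc ee ff.
have x1 : x^† * x = e + s t * s t * f.
  have -> : x^† * x = e * (u^† * u) * e + s t * s t * (f * f)
     + s t * (e * u^† * f + f * u * e) by rewrite xa /x; ncring.
  rewrite u1 f2 uf mulr1 e2 -[u * f * e]mulrA fe ue -[u^† * e * f]mulrA ef.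
  by rewrite !mulr0 addr0 mulr0 addr0.
have x2 : x * x^† = e + s t * s t * f.
  have -> : x * x^† = u * (e * e) * u^† + s t * s t * (f * f)
     + s t * (u * (e * f) + (f * e) * u^†) by rewrite xa /x; ncring.
  by rewrite e2 -eu -mulrA u2 f2 ef fe mulr1 mulr0 mul0r addr0 mulr0 addr0.
have y1 : y^† * y = e + s t * s t * f.
  have -> : y^† * y = e * e + s t * s t * (f * f) + s t * (e * f + f * e).
    by rewrite ya /y; ncring.
  by rewrite e2 f2 ef fe addr0 mulr0 addr0.
have y2 : y * y^† = e + s t * s t * f.
  have -> : y * y^† = e * e + s t * s t * (f * f) + s t * (e * f + f * e).
    by rewrite ya /y; ncring.
  by rewrite e2 f2 ef fe addr0 mulr0 addr0.
have PP : Pos C (1 - (e + s t * s t * f)).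
  have -> : 1 - (e + s t * s t * f) = s (1 - t * t) * (f^† * f).
    by rewrite ff f2 scB sc1 scM /f; ncring.
  apply: Pos_comm_mul; [apply: Pos_sc|exact: adjM_Pos|exact: scC].
  by rewrite subr_ge0 mulr_ile1.
split; [by apply/contraction_Pos; rewrite x1|by apply/contraction_Pos; rewrite y1|].
apply: relR1_intro; rewrite ?x1 ?x2 ?y1 ?y2 //.
have -> : 1 - (e + s t * s t * f) = s (1 - t * t) * f.
  by rewrite scB sc1 scM /f; ncring.
have fx : f * x = s t * f.
  have -> : f * x = f * u * e + s t * (f * f) by rewrite /x; ncring.
  by rewrite uf -mulrA fe mulr0 add0r f2.
have fy : f * y = s t * f.
  have -> : f * y = f * e + s t * (f * f) by rewrite /y; ncring.
  by rewrite fe add0r f2.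
by rewrite -!mulrA fx fy.
Qed.

End Corners.

(** * The C*-norm of the base algebra *)

Section BaseAlgebra.
Context (R : realType) (A : ucstarType R).
Implicit Types (x y : A).

Definition nA x : R := complex.Re `|x|.

Lemma normAE x : `|x| = (nA x)%:C%C.
Proof. by have := normr_ge0 x; rewrite /nA; case: `|x| => a b; rewrite lecE /= => /andP[/eqP -> _]. Qed.

Lemma nA_eq0 x : nA x = 0 -> x = 0.
Proof. by move=> E; apply: normr0_eq0; rewrite normAE E. Qed.

Lemma nAD x y : nA (x + y) <= nA x + nA y.
Proof. by have := ler_normD x y; rewrite !normAE -rmorphD lecR. Qed.

Lemma nAM x y : nA (x * y) <= nA x * nA y.
Proof. by have := cmul_norm x y; rewrite !normAE -rmorphM lecR. Qed.

Definition asc (r : R) : A := (r%:C)%C *: (1 : A).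

Fact asc_zmod : zmod_morphism asc.
Proof. by move=> r t; rewrite /asc rmorphB scalerBl. Qed.

Lemma cscaleAl (c : R[i]) x y : c *: x * y = c *: (x * y).
Proof. exact: cmul_scalel. Qed.

Lemma cscaleAr (c : R[i]) x y : x * (c *: y) = c *: (x * y).
Proof. exact: cmul_scaler. Qed.

Fact asc_monoid : monoid_morphism asc.
Proof.
split; first by rewrite /asc scale1r.
by move=> r t; rewrite /asc rmorphM cscaleAl mul1r scalerA.
Qed.

HB.instance Definition _ := GRing.isZmodMorphism.Build R A asc asc_zmod.
HB.instance Definition _ := GRing.isMonoidMorphism.Build R A asc asc_monoid.

Lemma star_mul x y : star (x * y) = star y * star x :> A.
Proof. exact: starM. Qed.

Lemma star1 : star (1 : A) = 1.
Proof.
by rewrite -[RHS](starK (1 : A)) -[X in _ = star X](mulr1 (star (1 : A))) star_mul starK mulr1.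
Qed.

Lemma nA_complete (u : nat -> A) :
    (forall e : R, 0 < e -> exists n0, forall m n, (n0 <= m)%N -> (n0 <= n)%N ->
       nA (u m - u n) < e) ->
    exists l, forall e : R, 0 < e -> exists n0, forall n, (n0 <= n)%N ->
       nA (u n - l) < e.
Proof.
move=> H.
have nlt x (e : R[i]) : 0 < e -> (`|x| < e) = (nA x < complex.Re e).
  by case: e => a b; rewrite ltcE /= => /andP[/eqP -> _]; rewrite normAE ltcR.
have Re0 (e : R[i]) : 0 < e -> 0 < complex.Re e.
  by case: e => a b; rewrite ltcE /= => /andP[].
have cu : cauchy (u @ \oo).
  apply/cauchy_ballP => e e0; have [n0 Hn] := H _ (Re0 _ e0).
  pose U := u @` [set n | (n0 <= n)%N].
  exists (U, U) => /=; first by split; exists n0 => // n n0n; exists n.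
  by move=> [_ _] /= [[m n0m <-] [n n0n <-]]; rewrite -ball_normE /= nlt //; exact: Hn.
have cv : cvg (u @ \oo) by apply: cauchy_cvg.
have /cvgrPdist_lt ul := cv; set l := lim _ in ul.
exists l => e e0; have e0' : 0 < (e%:C)%C by rewrite ltcR.
have [n0 _ Hn] := ul _ e0'; exists n0 => n /Hn /=.
by rewrite distrC nlt.
Qed.

Lemma star_asc r : star (asc r) = asc r.
Proof.
rewrite /asc starZ star1; congr (_ *: _).
by apply/eqP; rewrite eq_complex /= oppr0 !eqxx.
Qed.

Lemma ascC r x : asc r * x = x * asc r.
Proof. by rewrite /asc cscaleAl cscaleAr mul1r mulr1. Qed.

Lemma nA_ascM r x : nA (asc r * x) = `|r| * nA x.
Proof.
rewrite /asc cscaleAl mul1r {1}/nA normrZ normAE normc_def /=.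
by rewrite expr0n addr0 sqrtr_sqr mul0r subr0.
Qed.

Definition aim : A := ('i%C : R[i]) *: (1 : A).

Lemma aim_sqr : aim * aim = -1.
Proof. by rewrite /aim cscaleAl mul1r scalerA -expr2 sqr_i scaleN1r. Qed.

Lemma aimC x : aim * x = x * aim.
Proof. by rewrite /aim cscaleAl cscaleAr mul1r mulr1. Qed.

Lemma star_aim : star aim = - aim.
Proof. by rewrite /aim starZ star1 -scaleNr; congr (_ *: _); apply/eqP; rewrite eq_complex /= oppr0 !eqxx. Qed.

Lemma nA_star_ge x : nA x ^+ 2 <= nA (star x * x).
Proof. by rewrite -lecR rmorphXn /= -!normAE -cstar_norm. Qed.

Definition Acstar : cstar R A :=
  Cstar (@starK R A) (@starD R A) star_mul star_asc ascC aim_sqr aimC star_aim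
    nA_eq0 nAD nAM nA_ascM nA_star_ge nA_complete.

End BaseAlgebra.

(** * Hilbert modules over a C*-algebra *)

Section Adjoint.
Context (R : realType) (A : ucstarType R).

Lemma star0 : star (0 : A) = 0. Proof. exact: (adj_zero (Acstar A)). Qed.

Lemma starN : {morph @star R A : x / - x}.
Proof. exact: (adjN (Acstar A)). Qed.

Lemma nA0 : nA (0 : A) = 0. Proof. exact: (nrm0 (Acstar A)). Qed.

Lemma nA_starM (a : A) : nA (star a * a) = nA a ^+ 2.
Proof. exact: (nrm_adjM (Acstar A)). Qed.

Lemma star_sum I (r : seq I) (P : pred I) (F : I -> A) :
  star (\sum_(i <- r | P i) F i) = \sum_(i <- r | P i) star (F i).
Proof. by apply: (big_morph _ (@starD R A) star0). Qed.

Lemma adjmxE m n (T : 'M[A]_(m, n)) i j : adjmx T i j = star (T j i).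
Proof. by rewrite !mxE. Qed.

Lemma adjmxK m n : cancel (@adjmx R A m n) (@adjmx R A n m).
Proof. by move=> T; apply/matrixP => i j; rewrite !adjmxE starK. Qed.

Lemma adjmxD m n : {morph @adjmx R A m n : S T / S + T}.
Proof. by move=> S T; apply/matrixP => i j; rewrite !(adjmxE, mxE) starD. Qed.

Lemma adjmx0 m n : adjmx (0 : 'M[A]_(m, n)) = 0.
Proof. by apply/matrixP => i j; rewrite !(adjmxE, mxE) star0. Qed.

Lemma adjmxN m n : {morph @adjmx R A m n : T / - T}.
Proof. by move=> T; apply/matrixP => i j; rewrite !(adjmxE, mxE) starN. Qed.

Lemma adjmxB m n : {morph @adjmx R A m n : S T / S - T}.
Proof. by move=> S T; rewrite adjmxD adjmxN. Qed.

Lemma adjmxM m n p (S : 'M[A]_(m, n)) (T : 'M[A]_(n, p)) :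
  adjmx (S *m T) = adjmx T *m adjmx S.
Proof.
apply/matrixP => i j; rewrite !(adjmxE, mxE) star_sum.
by apply: eq_bigr => k _; rewrite star_mul !adjmxE.
Qed.

Lemma adjmx_scalar n (a : A) : adjmx (a%:M : 'M[A]_n) = (star a)%:M.
Proof.
apply/matrixP => i j; rewrite !(adjmxE, mxE) eq_sym.
by case: eqP => _; rewrite ?mulr1n // !mulr0n star0.
Qed.

Lemma adjmx1 n : adjmx (1%:M : 'M[A]_n) = 1%:M.
Proof. by rewrite adjmx_scalar star1. Qed.

Lemma adjmx_block m1 m2 n1 n2 (a : 'M[A]_(m1, n1)) (b : 'M[A]_(m1, n2))
    (c : 'M[A]_(m2, n1)) (d : 'M[A]_(m2, n2)) :
  adjmx (block_mx a b c d) = block_mx (adjmx a) (adjmx c) (adjmx b) (adjmx d).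
Proof. by rewrite /adjmx map_block_mx tr_block_mx. Qed.

End Adjoint.

Section HilbertModule.
Context (R : realType) (A : ucstarType R).
Local Notation PosA := (Pos (Acstar A)).

Definition ip n (x y : 'cV[A]_n) : A := \sum_i star (x i 0) * y i 0.

Section Fixed.
Context (n : nat).
Implicit Types (x y z : 'cV[A]_n) (c : A).

Lemma ipE x y : ip x y = (adjmx x *m y) 0 0.
Proof. by rewrite mxE; apply: eq_bigr => i _; rewrite adjmxE. Qed.

Lemma ipDr x y z : ip x (y + z) = ip x y + ip x z.
Proof. by rewrite !ipE mulmxDr mxE. Qed.

Lemma ipDl x y z : ip (x + y) z = ip x z + ip y z.
Proof. by rewrite !ipE adjmxD mulmxDl mxE. Qed.

Lemma ipNr x y : ip x (- y) = - ip x y.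
Proof. by rewrite !ipE mulmxN mxE. Qed.

Lemma ipNl x y : ip (- x) y = - ip x y.
Proof. by rewrite !ipE adjmxN mulNmx mxE. Qed.

Lemma ipZr x y c : ip x (y *m c%:M) = ip x y * c.
Proof.
rewrite !ipE mulmxA [LHS]mxE big_ord1; congr (_ * _).
by rewrite mxE eqxx mulr1n.
Qed.

Lemma star_ip x y : star (ip x y) = ip y x.
Proof. by rewrite star_sum; apply: eq_bigr => i _; rewrite star_mul starK. Qed.

Lemma ipZl x y c : ip (x *m c%:M) y = star c * ip x y.
Proof. by rewrite -star_ip ipZr star_mul star_ip. Qed.

Lemma PosA_sum I (r : seq I) (P : pred I) (F : I -> A) :
  (forall i, P i -> PosA (F i)) -> PosA (\sum_(i <- r | P i) F i).
Proof.
by move=> H; apply: big_ind => //; [exact: Pos0|exact: PosD].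
Qed.

Lemma ip_Pos x : PosA (ip x x).
Proof. by apply: PosA_sum => i _; exact: (adjM_Pos (Acstar A)). Qed.

Lemma hnorm_ge0 x : 0 <= hnorm x. Proof. exact: sqrtr_ge0. Qed.

Lemma nA_ge0 (a : A) : 0 <= nA a. Proof. exact: (nrm_ge0 (Acstar A)). Qed.

Lemma hnorm_sqr x : hnorm x ^+ 2 = nA (ip x x).
Proof. by rewrite sqr_sqrtr // nA_ge0. Qed.

(** With [c = ip y x] and [z = r x - y c] one has
    [r^2 ip x x - r c^* c = ip z z + c^* (r - ip y y) c >= 0]. *)
Lemma ip_CS_aux x y (r : R) : 0 < r -> nA (ip y y) <= r ->
  nA (ip y x) ^+ 2 <= r * nA (ip x x).
Proof.
move=> r0 yr; set c := ip y x; set s := asc A r; set z := x *m s%:M - y *m c%:M.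
have sC a : s * a = a * s by exact: ascC.
have zE : s * (s * ip x x) - s * (star c * c)
          = ip z z + star c * (s - ip y y) * c.
  rewrite /z !(ipDl, ipDr, ipNl, ipNr, ipZl, ipZr) star_asc -/s -/c.
  rewrite -[ip x y]star_ip -/c.
  have -> : star c * (s - ip y y) * c = s * (star c * c) - star c * ip y y * c.
    by rewrite mulrBr -(sC (star c)) mulrBl mulrA.
  by rewrite -(sC (ip x x)) mulNr -(sC (star c * c)); ncring.
have Pc a b : PosA a -> PosA (star b * a * b).
  move=> /Pos_sqrt[p [[pp _] pE _]].
  have -> : star b * a * b = star (p * b) * (p * b).
    by rewrite star_mul (pp : star p = p) -pE !mulrA.
  exact: (adjM_Pos (Acstar A)).
have P1 : PosA (s * (star c * c)).
  apply: Pos_comm_mul; last exact: sC.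
    by apply: (Pos_sc (Acstar A)); exact: ltW.
  exact: (adjM_Pos (Acstar A)).
have P2 : PosA (s * (s * ip x x) - s * (star c * c)).
  rewrite zE; apply: PosD; first exact: ip_Pos.
  apply: Pc; apply: (sc_sub_Pos (C := Acstar A)) => //.
  by have [] := ip_Pos y.
have := Pos_nrm_mono P1 P2; rewrite !(nrm_scM (Acstar A)) (nrm_adjM (Acstar A)).
by rewrite gtr0_norm // ler_pM2l.
Qed.

Lemma ip_CS x y : nA (ip y x) <= hnorm y * hnorm x.
Proof.
rewrite -(@ler_pXn2r _ 2) ?nnegrE ?mulr_ge0 ?hnorm_ge0 ?nA_ge0 //.
rewrite exprMn !hnorm_sqr.
apply/unstable.ler_gtP => u; set K := nA (ip y y); set B := nA (ip x x) => Hu.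
have B0 : 0 <= B by exact: nA_ge0.
have K0 : 0 <= K by exact: nA_ge0.
(* The auxiliary inequality needs a positive upper bound of [K], which may vanish. *)
set e := (u - K * B) / (B + 1).
have B1 : 0 < B + 1 by rewrite ltr_wpDl.
have e0 : 0 < e by rewrite divr_gt0 // subr_gt0.
have := @ip_CS_aux x y (K + e); rewrite ltr_wpDl // lerDl (ltW e0) => /(_ isT isT).
move/le_trans; apply; rewrite -/B mulrDl -lerBrDl.
have <- : e * (B + 1) = u - K * B by rewrite divfK ?gt_eqF.
by rewrite ler_wpM2l ?(ltW e0) // lerDl.
Qed.

Lemma hnormD x y : hnorm (x + y) <= hnorm x + hnorm y.
Proof.
rewrite -(@ler_pXn2r _ 2) ?nnegrE ?addr_ge0 ?hnorm_ge0 //.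
rewrite hnorm_sqr ipDl !ipDr.
have := nAD (ip x x + ip x y) (ip y x + ip y y).
have := nAD (ip x x) (ip x y); have := nAD (ip y x) (ip y y).
have := ip_CS x y; have := ip_CS y x; have := hnorm_sqr x; have := hnorm_sqr y.
by rewrite !expr2; nra.
Qed.

Lemma hnormZ x (r : R) : hnorm (x *m (asc A r)%:M) = `|r| * hnorm x.
Proof.
apply/eqP; rewrite -(@eqrXn2 _ 2) ?mulr_ge0 ?hnorm_ge0 //.
rewrite exprMn !hnorm_sqr ipZl ipZr star_asc -ascC !nA_ascM mulrA -expr2 //.
Qed.

(** This rests on [0 <= a <= b] implying [N a <= N b], since [ip x x] is a sum of
    positive elements. It makes the norm of a matrix finite. *)
Lemma hnorm_coord x i : nA (x i 0) <= hnorm x.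
Proof.
rewrite -(@ler_pXn2r _ 2) ?nnegrE ?hnorm_ge0 ?nA_ge0 //.
rewrite hnorm_sqr -(nrm_adjM (Acstar A)).
apply: Pos_nrm_mono; first exact: adjM_Pos.
have -> : ip x x - star (x i 0) * x i 0 = \sum_(j | j != i) star (x j 0) * x j 0.
  by rewrite /ip (bigD1 i) //= [LHS]addrC addKr.
by apply: PosA_sum => j _; exact: (adjM_Pos (Acstar A)).
Qed.

Lemma nA_sum I (r : seq I) (P : pred I) (F : I -> A) :
  nA (\sum_(i <- r | P i) F i) <= \sum_(i <- r | P i) nA (F i).
Proof.
elim/big_ind2: _ => // [|a1 b1 a2 b2 H1 H2]; first by rewrite nA0.
exact: le_trans (nAD _ _) (lerD H1 H2).
Qed.

Lemma hnorm_le_sum x : hnorm x <= \sum_i nA (x i 0).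
Proof.
have S0 : 0 <= \sum_i nA (x i 0) by apply: sumr_ge0 => i _; exact: nA_ge0.
rewrite -(@ler_pXn2r _ 2) ?nnegrE ?hnorm_ge0 //.
rewrite hnorm_sqr; apply: le_trans (nA_sum _ _ _) _.
rewrite expr2 mulr_suml; apply: ler_sum => i _.
rewrite nA_starM expr2 ler_wpM2l ?nA_ge0 //.
rewrite (bigD1 i) //= lerDl; apply: sumr_ge0 => j _; exact: nA_ge0.
Qed.

Lemma hnorm0 : hnorm (0 : 'cV[A]_n) = 0.
Proof.
apply/eqP; rewrite eq_le hnorm_ge0 andbT; apply: le_trans (hnorm_le_sum _) _.
by rewrite big1 // => i _; rewrite mxE nA0.
Qed.

Lemma hnorm_eq0 x : hnorm x = 0 -> x = 0.
Proof.
move=> E; apply/colP => i; rewrite mxE; apply: nA_eq0; apply/eqP.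
by rewrite eq_le nA_ge0 andbT -E hnorm_coord.
Qed.

End Fixed.
End HilbertModule.

(** * The C*-norm of matrix algebras *)

Section OperatorNorm.
Context (R : realType) (A : ucstarType R).

Definition entrysum m n (T : 'M[A]_(m, n)) : R := \sum_i \sum_j nA (T i j).

Lemma scalar_mx_central m n (a : A) (T : 'M[A]_(m, n)) :
  (forall b, a * b = b * a) -> a%:M *m T = T *m a%:M.
Proof.
move=> aC; rewrite mul_scalar_mx; apply/matrixP => i j.
rewrite !mxE (bigD1 j) //= big1 ?addr0; first by rewrite mxE eqxx mulr1n.
by move=> k /negPf kj; rewrite mxE kj mulr0n mulr0.
Qed.

Section Fixed.
Context (n : nat).
Implicit Types (S T : 'M[A]_n) (x : 'cV[A]_n).

Lemma hnorm_mx_bound T x : hnorm (T *m x) <= entrysum T * hnorm x.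
Proof.
apply: le_trans (hnorm_le_sum _) _; rewrite mulr_suml; apply: ler_sum => i _.
rewrite mxE; apply: le_trans (nA_sum _ _ _) _; rewrite mulr_suml.
apply: ler_sum => j _; apply: le_trans (nAM _ _) _.
by rewrite ler_wpM2l ?nA_ge0 // hnorm_coord.
Qed.

Lemma entrysum_ge0 T : 0 <= entrysum T.
Proof. by do 2![apply: sumr_ge0 => ? _]; exact: nA_ge0. Qed.

Let imgset T := [set hnorm (T *m x) | x in [set x : 'cV[A]_n | hnorm x <= 1]].

Lemma imgset_sup T : has_sup (imgset T).
Proof.
split; first by exists (hnorm (T *m 0)), 0 => //=; rewrite hnorm0.
exists (entrysum T) => _ [x /= x1 <-].
apply: le_trans (hnorm_mx_bound _ _) _.
by rewrite ler_piMr // entrysum_ge0.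
Qed.

Lemma mxnorm_le T c : (forall x, hnorm x <= 1 -> hnorm (T *m x) <= c) ->
  mxnorm T <= c.
Proof.
move=> H; apply: sup_le_ub; first by case: (imgset_sup T).
by move=> _ [x /= /H Hx <-].
Qed.

Lemma mxnorm_ge T x : hnorm x <= 1 -> hnorm (T *m x) <= mxnorm T.
Proof.
by move=> x1; apply: ub_le_sup; [case: (imgset_sup T)|exists x].
Qed.

Lemma mxnorm_le_entrysum T : mxnorm T <= entrysum T.
Proof.
apply: mxnorm_le => x x1; apply: le_trans (hnorm_mx_bound _ _) _.
by rewrite ler_piMr // entrysum_ge0.
Qed.

Lemma mxnorm_lt_entries T (e : R) : 0 < e ->
  (forall i j, nA (T i j) < e / (n * n).+1%:R) -> mxnorm T < e.
Proof.
move=> e0 H; apply: le_lt_trans (mxnorm_le_entrysum _) _.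
set d := e / _ in H; have d0 : 0 < d by rewrite divr_gt0.
have -> : e = (n * n).+1%:R * d by rewrite /d mulrC divfK // pnatr_eq0.
apply: (@le_lt_trans _ _ ((n * n)%:R * d)); last by rewrite ltr_pM2r // ltr_nat.
apply: (@le_trans _ _ (\sum_(i < n) \sum_(j < n) d)).
  by apply: ler_sum => i _; apply: ler_sum => j _; exact: ltW.
by rewrite !sumr_const card_ord -mulrnA mulr_natl.
Qed.

Lemma mxnorm_ge0 T : 0 <= mxnorm T.
Proof.
by apply: le_trans (mxnorm_ge T (x := 0) _); rewrite ?hnorm_ge0 // hnorm0.
Qed.

Lemma hnorm_mx T x : hnorm (T *m x) <= mxnorm T * hnorm x.
Proof.
have := hnorm_ge0 x; rewrite le_eqVlt => /orP[/eqP E|x0].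
  by rewrite (hnorm_eq0 (esym E)) mulmx0 hnorm0 mulr0.
set r := (hnorm x)^-1; have r0 : 0 < r by rewrite invr_gt0.
have : hnorm (x *m (asc A r)%:M) <= 1.
  by rewrite hnormZ gtr0_norm // mulVf // gt_eqF.
move/(mxnorm_ge T); rewrite mulmxA hnormZ gtr0_norm // mulrC.
by rewrite ler_pdivrMr.
Qed.

Lemma mxnorm_entry T i j : nA (T i j) <= mxnorm T.
Proof.
have d1 : hnorm (delta_mx j 0 : 'cV[A]_n) <= 1.
  rewrite -(@expr_le1 _ 2) ?hnorm_ge0 // hnorm_sqr /ip (bigD1 j) //= big1.
    by rewrite addr0 mxE !eqxx mulr1 star1 (nrm1_le1 (Acstar A)).
  by move=> k /negPf kj; rewrite !mxE kj mulr0.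
apply: le_trans (mxnorm_ge T d1); apply: le_trans (hnorm_coord _ i).
by rewrite -colE mxE.
Qed.

Lemma mxnorm_eq0 T : mxnorm T = 0 -> T = 0.
Proof.
move=> E; apply/matrixP => i j; rewrite mxE; apply: nA_eq0; apply/eqP.
by rewrite eq_le nA_ge0 andbT -E mxnorm_entry.
Qed.

Lemma mxnormD S T : mxnorm (S + T) <= mxnorm S + mxnorm T.
Proof.
apply: mxnorm_le => x x1; rewrite mulmxDl; apply: le_trans (hnormD _ _) _.
by apply: lerD; exact: mxnorm_ge.
Qed.

Lemma mxnormM S T : mxnorm (S * T) <= mxnorm S * mxnorm T.
Proof.
apply: mxnorm_le => x x1; rewrite -[_ *m x]mulmxA; apply: le_trans (hnorm_mx _ _) _.
by rewrite ler_wpM2l ?mxnorm_ge0 // mxnorm_ge.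
Qed.

Definition msc (r : R) : 'M[A]_n := (asc A r)%:M.

Fact msc_zmod : zmod_morphism msc.
Proof. by move=> r t; rewrite /msc rmorphB raddfB. Qed.

Fact msc_monoid : monoid_morphism msc.
Proof.
by split=> [|r t]; rewrite /msc ?rmorph1 // rmorphM scalar_mxM.
Qed.

HB.instance Definition _ := GRing.isZmodMorphism.Build R 'M[A]_n msc msc_zmod.
HB.instance Definition _ := GRing.isMonoidMorphism.Build R 'M[A]_n msc msc_monoid.

Lemma mscC r T : msc r * T = T * msc r.
Proof. by apply: scalar_mx_central; exact: ascC. Qed.

Lemma adj_msc r : adjmx (msc r) = msc r.
Proof. by rewrite adjmx_scalar star_asc. Qed.

Definition mim : 'M[A]_n := (aim A)%:M.

Lemma mim_sqr : mim * mim = -1.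
Proof. by rewrite -[LHS]scalar_mxM aim_sqr raddfN. Qed.

Lemma mimC T : mim * T = T * mim.
Proof. by apply: scalar_mx_central; exact: aimC. Qed.

Lemma adj_mim : adjmx mim = - mim.
Proof. by rewrite adjmx_scalar star_aim raddfN. Qed.

Lemma mxnorm_scM r T : mxnorm (msc r * T) = `|r| * mxnorm T.
Proof.
have le1 (t : R) S : mxnorm (msc t * S) <= `|t| * mxnorm S.
  apply: mxnorm_le => x x1.
  have -> : msc t * S *m x = S *m x *m (asc A t)%:M.
    by rewrite -scalar_mx_central ?mulmxA //; exact: ascC.
  by rewrite hnormZ ler_wpM2l // mxnorm_ge.
apply/eqP; rewrite eq_le le1 /=.
have [->|r0] := eqVneq r 0; first by rewrite normr0 mul0r mxnorm_ge0.
have := le1 r^-1 (msc r * T).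
rewrite mulrA -rmorphM mulVf // rmorph1 mul1r normfV.
by rewrite mulrC ler_pdivlMr ?normr_gt0 // mulrC.
Qed.

Lemma ip_adjmx T x (y : 'cV[A]_n) : ip (T *m x) y = ip x (adjmx T *m y).
Proof. by rewrite !ipE adjmxM mulmxA. Qed.

(** By Cauchy-Schwarz, as [ip (T x) (T x) = ip x (T^* T x)]. *)
Lemma mxnorm_adjM_ge T : mxnorm T ^+ 2 <= mxnorm (adjmx T * T).
Proof.
set c := mxnorm (adjmx T * T); have c0 : 0 <= c by exact: mxnorm_ge0.
rewrite -(sqr_sqrtr c0) ler_pXn2r ?nnegrE ?mxnorm_ge0 ?sqrtr_ge0 //.
apply: mxnorm_le => x x1.
rewrite -(@ler_pXn2r _ 2) ?nnegrE ?hnorm_ge0 ?sqrtr_ge0 //.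
rewrite hnorm_sqr (sqr_sqrtr c0) ip_adjmx mulmxA; apply: le_trans (ip_CS _ _) _.
rewrite -[leRHS]mul1r; apply: ler_pM; rewrite ?hnorm_ge0 //.
exact: mxnorm_ge.
Qed.

Lemma mxnorm_complete (u : nat -> 'M[A]_n) :
    (forall e : R, 0 < e -> exists n0, forall m n, (n0 <= m)%N -> (n0 <= n)%N ->
       mxnorm (u m - u n) < e) ->
    exists l, forall e : R, 0 < e -> exists n0, forall n, (n0 <= n)%N ->
       mxnorm (u n - l) < e.
Proof.
move=> H.
have lim_ij (ij : 'I_n * 'I_n) : exists a : A, forall e : R, 0 < e ->
    exists n0, forall k, (n0 <= k)%N -> nA (u k ij.1 ij.2 - a) < e.
  apply: nA_complete => e /H[n0 Hn]; exists n0 => k1 k2 n01 n02.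
  have := mxnorm_entry (u k1 - u k2) ij.1 ij.2; rewrite !mxE => /le_lt_trans; apply.
  exact: Hn.
have [f fP] := choice lim_ij.
exists (\matrix_(i, j) f (i, j)) => e e0.
set d := e / (n * n).+1%:R; have d0 : 0 < d by rewrite divr_gt0.
have [g gP] := choice (fun ij => fP ij d d0).
exists (\max_ij g ij) => k Hk.
apply: mxnorm_lt_entries => // i j; rewrite !mxE.
apply: (gP (i, j)); apply: leq_trans Hk.
exact: (@leq_bigmax _ g (i, j)).
Qed.

Definition Mcstar : cstar R 'M[A]_n :=
  Cstar (@adjmxK R A n n) (@adjmxD R A n n) (@adjmxM R A n n n) adj_msc mscC
    mim_sqr mimC adj_mim mxnorm_eq0 mxnormD mxnormM mxnorm_scM mxnorm_adjM_ge
    mxnorm_complete.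

End Fixed.
End OperatorNorm.

(** * Paths of matrices *)

Lemma prod_small (R : realFieldType) (p q G F d e : R) :
  0 <= p -> 0 <= q -> 0 <= G -> 0 <= F -> p < d -> q < d -> d <= 1 ->
  d * (G + 1 + F) <= e -> p * G + p * q + F * q < e.
Proof.
move=> p0 q0 G0 F0 pd qd d1 dK.
have h1 : p * G <= d * G by rewrite ler_wpM2r // ltW.
have h2 : p * q <= d * q by rewrite ler_wpM2r // ltW.
have h3 : d * q < d by rewrite gtr_pMr; lra.
have h4 : F * q <= F * d by rewrite ler_wpM2l // ltW.
lra.
Qed.

Section EntryPaths.
Context (R : realType) (A : ucstarType R).
Implicit Types (f g : R -> A) (t : R).

Definition epath f := forall t, t \in `[0, 1] -> forall e : R, 0 < e ->
  \forall s \near t, s \in `[0, 1] -> nA (f s - f t) < e.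

Lemma epath_cst (a : A) : epath (fun=> a).
Proof. by move=> t _ e e0; near=> s => _; rewrite subrr nA0. Unshelve. all: by end_near. Qed.

Lemma eq_epath f g : f =1 g -> epath f -> epath g.
Proof. by move=> /funext ->. Qed.

Lemma epathD f g : epath f -> epath g -> epath (fun t => f t + g t).
Proof.
move=> fc gc t t01 e e0; have e2 : 0 < e / 2 by rewrite divr_gt0.
near=> s => s01.
have -> : f s + g s - (f t + g t) = (f s - f t) + (g s - g t) by ncring.
apply: le_lt_trans (nAD _ _) _; rewrite [e]splitr.
by apply: ltrD; move: s01; [near: s; exact: fc|near: s; exact: gc].
Unshelve. all: by end_near. Qed.

Lemma epathM f g : epath f -> epath g -> epath (fun t => f t * g t).
Proof.
move=> fc gc t t01 e e0.
set K := nA (g t) + 1 + nA (f t).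
have K0 : 0 < K by rewrite /K -addrA ltr_wpDl ?nA_ge0 // ltr_wpDr ?nA_ge0.
set d := Num.min 1 (e / K).
have d0 : 0 < d by rewrite lt_min ltr01 divr_gt0.
near=> s => s01.
have fd : nA (f s - f t) < d by move: s01; near: s; exact: fc.
have gd : nA (g s - g t) < d by move: s01; near: s; exact: gc.
have -> : f s * g s - f t * g t
        = (f s - f t) * g t + (f s - f t) * (g s - g t) + f t * (g s - g t).
  by ncring.
have d1 : d <= 1 by rewrite ge_min lexx.
have dK : d * K <= e by rewrite -ler_pdivlMr // ge_min lexx orbT.
apply: le_lt_trans (prod_small (nA_ge0 _) (nA_ge0 _) (nA_ge0 _) (nA_ge0 _) fd gd d1 dK).
apply: le_trans (nAD _ _) (lerD _ (nAM _ _)).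
exact: le_trans (nAD _ _) (lerD (nAM _ _) (nAM _ _)).
Unshelve. all: by end_near. Qed.

Lemma epath_sum I (r : seq I) (P : pred I) (F : I -> R -> A) :
  (forall i, epath (F i)) -> epath (fun t => \sum_(i <- r | P i) F i t).
Proof.
move=> H; elim: r => [|i r IH].
  by apply: eq_epath (epath_cst 0) => t; rewrite big_nil.
case Pi: (P i).
  by apply: eq_epath (epathD (H i) IH) => t; rewrite big_cons Pi.
by apply: eq_epath IH => t; rewrite big_cons Pi.
Qed.

Lemma epath_star f : epath f -> epath (fun t => star (f t)).
Proof.
move=> fc t t01 e e0; near=> s => s01.
rewrite -starN -starD -[nA _]/(nrm (Acstar A) (adj (Acstar A) _)) nrm_adj.
by move: s01; near: s; exact: fc.
Unshelve. all: by end_near. Qed.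

Lemma epath_asc (h : R -> R) : continuous h -> epath (fun t => asc A (h t)).
Proof.
move=> hc t t01 e e0; near=> s => s01.
rewrite -rmorphB /=; apply: le_lt_trans (nrm_sc_le (Acstar A) _) _.
rewrite distrC; near: s; have /cvgrPdist_lt := hc t; exact.
Unshelve. all: by end_near. Qed.

Lemma epath_comp f (h : R -> R) : continuous h ->
  (forall t, t \in `[0, 1] -> h t \in `[0, 1]) ->
  epath f -> epath (f \o h).
Proof.
move=> hc h01 fc t t01 e e0; have := fc _ (h01 t t01) e e0.
move=> /(hc t) H; near=> s => s01.
have : h s \in `[0, 1] -> nA (f (h s) - f (h t)) < e by near: s; exact: H.
by apply; exact: h01.
Unshelve. all: by end_near.
Qed.

End EntryPaths.

Section MatrixPaths.
Context (R : realType) (A : ucstarType R).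

(** Continuity of the entries, which makes sense for rectangular matrices. *)
Definition mxpath m n (f : R -> 'M[A]_(m, n)) := forall i j, epath (fun t => f t i j).

(** The operator norm lies between the norm of each entry and the sum of these norms. *)
Lemma norm_path_mxpath n (f : R -> 'M[A]_n) : norm_path f <-> mxpath f.
Proof.
split=> [fc i j t t01 e e0|fc t t01].
  have /cvgrPdist_lt /(_ e e0) := fc t t01.
  rewrite near_withinE => H; near=> s => s01.
  have : `|0 - mxnorm (f s - f t)| < e by move: s01; near: s; exact: H.
  rewrite sub0r normrN ger0_norm ?mxnorm_ge0 //.
  by apply: le_lt_trans; have := mxnorm_entry (f s - f t) i j; rewrite !mxE.
apply/cvgrPdist_lt => e e0; rewrite near_withinE.
have d0 : 0 < e / (n * n).+1%:R by rewrite divr_gt0.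
have H : \forall s \near t, forall ij : 'I_n * 'I_n,
    s \in `[0, 1] -> nA (f s ij.1 ij.2 - f t ij.1 ij.2) < e / (n * n).+1%:R.
  pose Q (ij : 'I_n * 'I_n) (s : R) := s \in `[0, 1] ->
    nA (f s ij.1 ij.2 - f t ij.1 ij.2) < e / (n * n).+1%:R.
  by apply: (@filter_forall _ _ Q (nbhs t)) => -[i j]; exact: fc.
near=> s => s01.
have Hs ij : nA (f s ij.1 ij.2 - f t ij.1 ij.2) < e / (n * n).+1%:R.
  by move: ij s01; near: s; exact: H.
rewrite sub0r normrN ger0_norm ?mxnorm_ge0 //.
apply: mxnorm_lt_entries => // i j; rewrite !mxE.
exact: (Hs (i, j)).
Unshelve. all: by end_near.
Qed.

Lemma mxpath_cst m n (a : 'M[A]_(m, n)) : mxpath (fun=> a).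
Proof. by move=> i j; exact: epath_cst. Qed.

Lemma mxpathD m n (f g : R -> 'M[A]_(m, n)) :
  mxpath f -> mxpath g -> mxpath (fun t => f t + g t).
Proof.
by move=> fc gc i j; apply: eq_epath (epathD (fc i j) (gc i j)) => t; rewrite mxE.
Qed.

Lemma mxpathM m n p (f : R -> 'M[A]_(m, n)) (g : R -> 'M[A]_(n, p)) :
  mxpath f -> mxpath g -> mxpath (fun t => f t *m g t).
Proof.
move=> fc gc i j; apply: (@eq_epath _ _ (fun t => \sum_k f t i k * g t k j)).
  by move=> t; rewrite mxE.
by apply: epath_sum => k; exact: epathM.
Qed.

Lemma mxpath_adj m n (f : R -> 'M[A]_(m, n)) :
  mxpath f -> mxpath (fun t => adjmx (f t)).
Proof.
by move=> fc i j; apply: eq_epath (epath_star (fc j i)) => t; rewrite adjmxE.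
Qed.

Lemma mxpath_scalar n (f : R -> A) : epath f -> mxpath (fun t => (f t)%:M : 'M[A]_n).
Proof.
move=> fc i j; case: (eqVneq i j) => [<-|ij].
  by apply: eq_epath fc => t; rewrite mxE eqxx mulr1n.
by apply: eq_epath (epath_cst 0) => t; rewrite mxE (negPf ij) mulr0n.
Qed.

Lemma mxpathN m n (f : R -> 'M[A]_(m, n)) : mxpath f -> mxpath (fun t => - f t).
Proof.
move=> fc; have := mxpathM (mxpath_cst (- 1%:M)) fc.
by rewrite (_ : (fun t => _) = fun t => - f t) //; apply/funext => t; rewrite mulNmx mul1mx.
Qed.

Lemma mxpathB m n (f g : R -> 'M[A]_(m, n)) :
  mxpath f -> mxpath g -> mxpath (fun t => f t - g t).
Proof. by move=> fc gc; apply: mxpathD => //; exact: mxpathN. Qed.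

Lemma mxpath_comp m n (f : R -> 'M[A]_(m, n)) (h : R -> R) : continuous h ->
  (forall t, t \in `[0, 1] -> h t \in `[0, 1]) ->
  mxpath f -> mxpath (f \o h).
Proof. by move=> hc h01 fc i j; exact: epath_comp (fc i j). Qed.

(** Concatenation. As a sum, it is continuous without case analysis on [t]. *)
Definition mxglue m n (f g : R -> 'M[A]_(m, n)) (t : R) :=
  f (Num.min (2 * t) 1) + g (Num.max (2 * t - 1) 0) - f 1.

Lemma mxglue_path m n (f g : R -> 'M[A]_(m, n)) :
  mxpath f -> mxpath g -> mxpath (mxglue f g).
Proof.
move=> fc gc; apply: mxpathB; last exact: mxpath_cst.
have c2 : continuous (fun t : R => 2 * t) by exact: mulrl_continuous.
apply: mxpathD.
  apply: (@mxpath_comp _ _ f (fun t => Num.min (2 * t) 1)) => //.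
    by move=> t; apply: continuous_min; [exact: c2|exact: cvg_cst].
  by move=> t; rewrite !in_itv /= => /andP[a b]; rewrite le_min ge_min; lra.
apply: (@mxpath_comp _ _ g (fun t => Num.max (2 * t - 1) 0)) => //.
  move=> t; apply: (@continuous_max R R (fun u => 2 * u - 1) (fun=> 0)); last exact: cvg_cst.
  by apply: cvgB; [exact: c2|exact: cvg_cst].
by move=> t; rewrite !in_itv /= => /andP[a b]; rewrite le_max ge_max; lra.
Qed.

Lemma mxglue_left m n (f g : R -> 'M[A]_(m, n)) t : f 1 = g 0 -> t <= 2^-1 ->
  mxglue f g t = f (2 * t).
Proof.
move=> E t2; rewrite /mxglue min_l; last lra.
by rewrite max_r ?E ?addrK //; lra.
Qed.

Lemma mxglue_right m n (f g : R -> 'M[A]_(m, n)) t : 2^-1 <= t ->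
  mxglue f g t = g (2 * t - 1).
Proof.
move=> t2; rewrite /mxglue min_r; last lra.
rewrite max_l; last lra.
by rewrite addrC addKr.
Qed.

Lemma mxglue0 m n (f g : R -> 'M[A]_(m, n)) : f 1 = g 0 -> mxglue f g 0 = f 0.
Proof. by move=> E; rewrite mxglue_left ?mulr0 ?invr_ge0. Qed.

Lemma mxglue1 m n (f g : R -> 'M[A]_(m, n)) : mxglue f g 1 = g 1.
Proof.
rewrite mxglue_right; last lra.
by congr g; lra.
Qed.

End MatrixPaths.

(** * Isometric embeddings of matrix algebras *)

Section Isometries.
Context (R : realType) (A : ucstarType R).

Definition mx_isometry N n (S : 'M[A]_(N, n)) := adjmx S *m S = 1%:M.
Definition orthogonal_ranges N n m (S : 'M[A]_(N, n)) (T : 'M[A]_(N, m)) :=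
  adjmx S *m T = 0.

(** The extension of [a] by zero outside the range of [S]. *)
Definition cor N n (S : 'M[A]_(N, n)) (a : 'M[A]_n) : 'M[A]_N :=
  S *m a *m adjmx S.

(** The extension of [u] by the identity outside the range of [S]. *)
Definition emb N n (S : 'M[A]_(N, n)) (u : 'M[A]_n) : 'M[A]_N :=
  1%:M + cor S (u - 1%:M).

Lemma orthogonal_ranges_sym N n m (S : 'M[A]_(N, n)) (T : 'M[A]_(N, m)) :
  orthogonal_ranges S T -> orthogonal_ranges T S.
Proof.
move=> ST; apply: (can_inj (@adjmxK _ _ _ _)).
by rewrite adjmxM adjmxK ST !adjmx0.
Qed.

Lemma mx_isometry_comp N n m (S : 'M[A]_(N, n)) (T : 'M[A]_(n, m)) :
  mx_isometry S -> mx_isometry T -> mx_isometry (S *m T).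
Proof.
by move=> S1 T1; rewrite /mx_isometry adjmxM mulmxA -(mulmxA (adjmx T)) S1 mulmx1.
Qed.

Lemma orthogonal_ranges_comp N n n' m m' (S : 'M[A]_(N, n)) (T : 'M[A]_(N, m))
    (S' : 'M[A]_(n, n')) (T' : 'M[A]_(m, m')) :
  orthogonal_ranges S T -> orthogonal_ranges (S *m S') (T *m T').
Proof.
move=> ST; rewrite /orthogonal_ranges adjmxM mulmxA -(mulmxA _ (adjmx S)) ST.
by rewrite mulmx0 mul0mx.
Qed.

Lemma mx_isometry1 n : mx_isometry (1%:M : 'M[A]_n).
Proof. by rewrite /mx_isometry adjmx1 mulmx1. Qed.

Section Cor.
Context (N n : nat) (S : 'M[A]_(N, n)).
Implicit Types a b u v : 'M[A]_n.

Lemma corD a b : cor S (a + b) = cor S a + cor S b.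
Proof. by rewrite /cor mulmxDr mulmxDl. Qed.

Lemma corN a : cor S (- a) = - cor S a.
Proof. by rewrite /cor mulmxN mulNmx. Qed.

Lemma corB a b : cor S (a - b) = cor S a - cor S b.
Proof. by rewrite corD corN. Qed.

Lemma cor0 : cor S 0 = 0.
Proof. by rewrite /cor mulmx0 mul0mx. Qed.

Lemma adj_cor a : adjmx (cor S a) = cor S (adjmx a).
Proof. by rewrite /cor !adjmxM adjmxK mulmxA. Qed.

Lemma cor_comp m (T : 'M[A]_(n, m)) (a : 'M[A]_m) :
  cor S (cor T a) = cor (S *m T) a.
Proof. by rewrite /cor adjmxM !mulmxA. Qed.

Lemma cor_orth m (T : 'M[A]_(N, m)) a (b : 'M[A]_m) :
  orthogonal_ranges S T -> cor S a *m cor T b = 0.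
Proof.
move=> ST; rewrite /cor !mulmxA -(mulmxA _ (adjmx S) T) ST.
by rewrite mulmx0 !mul0mx.
Qed.

Lemma emb_comp m (T : 'M[A]_(n, m)) (v : 'M[A]_m) : emb S (emb T v) = emb (S *m T) v.
Proof. by rewrite {1 2}/emb [1%:M + cor T _]addrC addrK cor_comp. Qed.

Lemma emb1 : emb S 1%:M = 1%:M.
Proof. by rewrite /emb subrr cor0 addr0. Qed.

Lemma adj_emb u : adjmx (emb S u) = emb S (adjmx u).
Proof. by rewrite /emb adjmxD adjmx1 adj_cor adjmxB adjmx1. Qed.

Hypothesis S1 : mx_isometry S.

Lemma corM a b : cor S a *m cor S b = cor S (a *m b).
Proof. by rewrite /cor !mulmxA -(mulmxA _ (adjmx S) S) S1 mulmx1. Qed.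

Lemma embM u v : emb S (u *m v) = emb S u *m emb S v.
Proof.
rewrite /emb mulmxDl !mulmxDr !mul1mx !mulmx1 corM -!addrA; congr (_ + _).
rewrite -!corD; congr cor.
rewrite mulmxBl !mulmxBr !mulmx1 !mul1mx.
by rewrite -[_ *m v]/(u * v); ncring.
Qed.

Lemma emb_unitary u : is_unitary u -> is_unitary (emb S u).
Proof. by move=> [u1 u2]; split; rewrite adj_emb -embM ?u1 ?u2 emb1. Qed.

End Cor.

Lemma cor_id n (a : 'M[A]_n) : cor 1%:M a = a.
Proof. by rewrite /cor adjmx1 mulmx1 mul1mx. Qed.

Lemma emb_id n (a : 'M[A]_n) : emb 1%:M a = a.
Proof. by rewrite /emb cor_id addrC subrK. Qed.

Lemma emb_mul_orth N n m (S : 'M[A]_(N, n)) (T : 'M[A]_(N, m)) u v :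
  orthogonal_ranges S T ->
  emb S u *m emb T v = 1%:M + cor S (u - 1%:M) + cor T (v - 1%:M).
Proof.
move=> ST; rewrite /emb mulmxDl !mulmxDr !mul1mx !mulmx1 cor_orth // addr0.
by rewrite -!addrA [cor T _ + _]addrC.
Qed.

(** The inclusion of [A^n] into [A^N] as the coordinates [k, ..., k + n - 1]. *)
Definition shiftmx N n k : 'M[A]_(N, n) :=
  \matrix_(i, j) (i == (k + j)%N :> nat)%:R.

Lemma adj_shiftmx_mul N n m k l : (k + n <= N)%N ->
  adjmx (shiftmx N n k) *m shiftmx N m l = \matrix_(i, j) (k + i == l + j)%N%:R.
Proof.
move=> kn; apply/matrixP => i j; rewrite !mxE.
have kiN : (k + i < N)%N by apply: leq_trans kn; rewrite ltn_add2l.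
rewrite (bigD1 (Ordinal kiN)) //= big1 ?addr0.
  by rewrite adjmxE !mxE /= eqxx star1 mul1r.
move=> h; rewrite adjmxE !mxE -val_eqE /= => /negPf ->.
by rewrite star0 mul0r.
Qed.

Lemma shiftmx_isometry N n k : (k + n <= N)%N -> mx_isometry (shiftmx N n k).
Proof.
move=> kn; rewrite /mx_isometry adj_shiftmx_mul //; apply/matrixP => i j.
by rewrite !mxE eqn_add2l val_eqE; case: eqP.
Qed.

Lemma shiftmx_orth N n m k l : (k + n <= N)%N -> (k + n <= l)%N || (l + m <= k)%N ->
  orthogonal_ranges (shiftmx N n k) (shiftmx N m l).
Proof.
move=> kn kl; rewrite /orthogonal_ranges adj_shiftmx_mul //.
apply/matrixP => i j; rewrite !mxE; case: eqP => //= E.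
by have := ltn_ord i; have := ltn_ord j; lia.
Qed.

Lemma shiftmx_left n k : shiftmx (n + k) n 0 = col_mx 1%:M 0.
Proof.
apply/matrixP => i j; rewrite !mxE add0n; case: (splitP i) => i' E.
  by rewrite E !mxE val_eqE; case: eqP.
rewrite mxE E; case: eqP => //= F.
by have := ltn_ord j; rewrite -F ltnNge leq_addr.
Qed.

Lemma shiftmx_right n k : shiftmx (n + k) k n = col_mx 0 1%:M.
Proof.
apply/matrixP => i j; rewrite !mxE; case: (splitP i) => i' E.
  rewrite mxE E; case: eqP => //= F.
  by have := ltn_ord i'; rewrite F ltnNge leq_addr.
by rewrite !mxE E eqn_add2l val_eqE; case: eqP.
Qed.

Lemma adjmx_col N n m (S : 'M[A]_(N, m)) (T : 'M[A]_(n, m)) :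
  adjmx (col_mx S T) = row_mx (adjmx S) (adjmx T).
Proof. by rewrite /adjmx map_col_mx tr_col_mx. Qed.

Lemma cor_left n k (a : 'M[A]_n) : cor (shiftmx (n + k) n 0) a = dsum a 0.
Proof.
rewrite /cor shiftmx_left mul_col_mx mul1mx mul0mx adjmx_col adjmx1 adjmx0.
by rewrite mul_col_row !mulmx0 !mul0mx mulmx1.
Qed.

Lemma cor_right n k (a : 'M[A]_k) : cor (shiftmx (n + k) k n) a = dsum 0 a.
Proof.
rewrite /cor shiftmx_right mul_col_mx mul1mx mul0mx adjmx_col adjmx1 adjmx0.
by rewrite mul_col_row !mulmx0 !mul0mx mulmx1.
Qed.

Lemma dsum_cor n k (a : 'M[A]_n) (b : 'M[A]_k) :
  dsum a b = cor (shiftmx (n + k) n 0) a + cor (shiftmx (n + k) k n) b.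
Proof. by rewrite cor_left cor_right /dsum add_block_mx !addr0 add0r. Qed.

Lemma dsum_emb n k (u : 'M[A]_n) (v : 'M[A]_k) :
  dsum u v = emb (shiftmx (n + k) n 0) u *m emb (shiftmx (n + k) k n) v.
Proof.
rewrite emb_mul_orth; last by apply: shiftmx_orth; rewrite ?add0n ?leq_addr ?leqnn.
rewrite -addrA -dsum_cor scalar_mx_block /dsum add_block_mx !addr0.
by congr block_mx; rewrite addrC subrK.
Qed.

Lemma castmx_dsum1 n k N (e : (n + k = N)%N) (u : 'M[A]_n) :
  castmx (e, e) (dsum u 1%:M) = emb (shiftmx N n 0) u.
Proof. by case: N / e; rewrite castmx_id dsum_emb emb1 mulmx1. Qed.

Lemma castmx_corner n k N (e : (n + k = N)%N) (a : 'M[A]_n) :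
  castmx (e, e) (corner k a) = cor (shiftmx N n 0) a.
Proof. by case: N / e; rewrite castmx_id cor_left. Qed.

End Isometries.

(** * Stable homotopy of unitaries *)

Section UnitaryHomotopies.
Context (R : realType) (A : ucstarType R).

Lemma mem01_0 : (0 : R) \in `[0, 1]. Proof. by rewrite in_itv /= lexx ler01. Qed.

Lemma onem_continuous : continuous (fun t : R => 1 - t).
Proof. by move=> t; apply: cvgB; [exact: cvg_cst|exact: cvg_id]. Qed.

Lemma onem_mem01 (t : R) : t \in `[0, 1] -> 1 - t \in `[0, 1].
Proof. by rewrite !in_itv /=; lra. Qed.

Lemma path_rev m n (f : R -> 'M[A]_(m, n)) : mxpath f -> mxpath (fun t => f (1 - t)).
Proof. exact: (mxpath_comp onem_continuous onem_mem01). Qed.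

Lemma halves01 (t : R) : t \in `[0, 1] ->
  (2 * t \in `[0, 1] /\ t <= 2^-1) \/ (2 * t - 1 \in `[0, 1] /\ 2^-1 <= t).
Proof. by rewrite !in_itv /=; have [] := lerP t 2^-1; [left|right]; split; lra. Qed.

Lemma uh_refl n (u : 'M[A]_n) : is_unitary u -> unitary_homotopic u u.
Proof. by move=> uu; exists (fun=> u); split=> //; apply/norm_path_mxpath/mxpath_cst. Qed.

Lemma uh_sym n (u v : 'M[A]_n) : unitary_homotopic u v -> unitary_homotopic v u.
Proof.
move=> [f [/norm_path_mxpath fc f0 f1 fu]]; exists (fun t => f (1 - t)); split.
- by apply/norm_path_mxpath; exact: path_rev.
- by rewrite subr0.
- by rewrite subrr.
- by move=> t /onem_mem01; exact: fu.
Qed.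

Lemma uh_trans n (u v w : 'M[A]_n) :
  unitary_homotopic u v -> unitary_homotopic v w -> unitary_homotopic u w.
Proof.
move=> [f [/norm_path_mxpath fc f0 f1 fu]] [g [/norm_path_mxpath gc g0 g1 gu]].
have fg : f 1 = g 0 by rewrite f1 g0.
exists (mxglue f g); split.
- by apply/norm_path_mxpath; exact: mxglue_path.
- by rewrite mxglue0.
- by rewrite mxglue1.
- move=> t /halves01[[t01 t2]|[t01 t2]].
    by rewrite mxglue_left //; exact: fu.
  by rewrite mxglue_right //; exact: gu.
Qed.

Lemma unitaryM n (u v : 'M[A]_n) : is_unitary u -> is_unitary v -> is_unitary (u *m v).
Proof.
move=> [u1 u2] [v1 v2]; split; rewrite adjmxM.
  by rewrite mulmxA -(mulmxA _ _ u) u1 mulmx1.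
by rewrite mulmxA -(mulmxA u) v2 mulmx1.
Qed.

Lemma unitary1 n : is_unitary (1%:M : 'M[A]_n).
Proof. by split; rewrite adjmx1 mulmx1. Qed.

Lemma unitary_adj n (u : 'M[A]_n) : is_unitary u -> is_unitary (adjmx u).
Proof. by move=> [u1 u2]; split; rewrite adjmxK. Qed.

Lemma uh_mul n (u v u' v' : 'M[A]_n) : unitary_homotopic u u' ->
  unitary_homotopic v v' -> unitary_homotopic (u *m v) (u' *m v').
Proof.
move=> [f [/norm_path_mxpath fc f0 f1 fu]] [g [/norm_path_mxpath gc g0 g1 gu]].
exists (fun t => f t *m g t); split.
- by apply/norm_path_mxpath; exact: mxpathM.
- by rewrite f0 g0.
- by rewrite f1 g1.
- by move=> t t01; apply: unitaryM; [exact: fu|exact: gu].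
Qed.

Lemma mxpath_cor N n (S : 'M[A]_(N, n)) (f : R -> 'M[A]_n) : mxpath f ->
  mxpath (fun t => cor S (f t)).
Proof.
by move=> fc; apply: mxpathM; [apply: mxpathM|]; rewrite //; exact: mxpath_cst.
Qed.

Lemma uh_emb N n (S : 'M[A]_(N, n)) (u v : 'M[A]_n) : mx_isometry S ->
  unitary_homotopic u v -> unitary_homotopic (emb S u) (emb S v).
Proof.
move=> S1 [f [/norm_path_mxpath fc f0 f1 fu]]; exists (fun t => emb S (f t)); split.
- apply/norm_path_mxpath/mxpathD; first exact: mxpath_cst.
  by apply: mxpath_cor; apply: mxpathB => //; exact: mxpath_cst.
- by rewrite f0.
- by rewrite f1.
- by move=> t t01; apply: emb_unitary => //; exact: fu.
Qed.

(** A parametrization of the quarter circle whose endpoint values are immediate. *)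
Definition rcos (t : R) := Num.sqrt (1 - t).
Definition rsin (t : R) := Num.sqrt t.

Lemma rcos_continuous : continuous rcos.
Proof.
by move=> t; apply: (@continuous_comp _ _ _ (fun t : R => 1 - t) Num.sqrt);
  [exact: onem_continuous|exact: sqrt_continuous].
Qed.

Lemma rsin_continuous : continuous rsin.
Proof. exact: sqrt_continuous. Qed.

Lemma rcos_rsin t : t \in `[0, 1] -> rcos t * rcos t + rsin t * rsin t = 1.
Proof.
rewrite in_itv /= => /andP[t0 t1]; rewrite -!expr2 !sqr_sqrtr ?subr_ge0 //.
by rewrite subrK.
Qed.

Lemma rcos0 : rcos 0 = 1. Proof. by rewrite /rcos subr0 sqrtr1. Qed.
Lemma rcos1 : rcos 1 = 0. Proof. by rewrite /rcos subrr sqrtr0. Qed.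
Lemma rsin0 : rsin 0 = 0. Proof. exact: sqrtr0. Qed.
Lemma rsin1 : rsin 1 = 1. Proof. exact: sqrtr1. Qed.

Lemma mxpath_msc n (h : R -> R) : continuous h -> mxpath (fun t => msc A n (h t)).
Proof.
by move=> hc; apply: (@mxpath_scalar _ _ _ (fun t => asc A (h t))); exact: epath_asc.
Qed.

Lemma msc0 n : msc A n 0 = 0. Proof. exact: rmorph0. Qed.
Lemma msc1 n : msc A n 1 = 1%:M. Proof. exact: rmorph1. Qed.

Definition rotmx N n (S T : 'M[A]_(N, n)) (t : R) : 'M[A]_(N, n) :=
  msc A N (rcos t) *m S + msc A N (rsin t) *m T.

Lemma rotmx_isometry N n (S T : 'M[A]_(N, n)) t : mx_isometry S -> mx_isometry T ->
  orthogonal_ranges S T -> t \in `[0, 1] -> mx_isometry (rotmx S T t).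
Proof.
move=> S1 T1 ST t01; have TS := orthogonal_ranges_sym ST.
have mid (p q : R) (X Y : 'M[A]_(N, n)) :
    adjmx (msc A N p *m X) *m (msc A N q *m Y) = msc A n (p * q) *m (adjmx X *m Y).
  rewrite adjmxM adj_msc !mulmxA -(mulmxA _ (msc A N p)) -[msc A N p *m _]scalar_mxM.
  by rewrite -rmorphM -scalar_mx_central //; exact: ascC.
rewrite /mx_isometry /rotmx adjmxD mulmxDl !mulmxDr !mid S1 T1 ST TS.
rewrite !mulmx0 addr0 add0r !mulmx1 -[msc A n _]/(msc A n _).
by rewrite -rmorphD /= rcos_rsin // rmorph1.
Qed.

(** The rotation from [S] to [T] is a path of isometries. *)
Lemma uh_emb_orth N n (S T : 'M[A]_(N, n)) (u : 'M[A]_n) : mx_isometry S -> mx_isometry T ->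
  orthogonal_ranges S T -> is_unitary u -> unitary_homotopic (emb S u) (emb T u).
Proof.
move=> S1 T1 ST uu; exists (fun t => emb (rotmx S T t) u).
have rc : mxpath (rotmx S T).
  apply: mxpathD; apply: mxpathM; try exact: (mxpath_cst S); try exact: (mxpath_cst T).
    exact: mxpath_msc rcos_continuous.
  exact: mxpath_msc rsin_continuous.
split.
- apply/norm_path_mxpath/mxpathD; first exact: mxpath_cst.
  apply: mxpathM; [apply: mxpathM|] => //; first exact: mxpath_cst.
  exact: mxpath_adj.
- by rewrite /rotmx rcos0 rsin0 msc0 msc1 mul0mx mul1mx addr0.
- by rewrite /rotmx rcos1 rsin1 msc0 msc1 mul0mx mul1mx add0r.
- by move=> t t01; apply: emb_unitary => //; exact: rotmx_isometry.
Qed.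

(** Allowing all isometries in place of the corner inclusions avoids comparing matrix
    sizes, and it makes the independence of the embedding immediate. *)
Definition stable n m (u : 'M[A]_n) (v : 'M[A]_m) :=
  exists N (S : 'M[A]_(N, n)) (T : 'M[A]_(N, m)),
    [/\ mx_isometry S, mx_isometry T & unitary_homotopic (emb S u) (emb T v)].

Lemma stable_emb N n (S : 'M[A]_(N, n)) (u : 'M[A]_n) : mx_isometry S -> is_unitary u ->
  stable (emb S u) u.
Proof.
move=> S1 uu; exists N, 1%:M, S; split=> //; first exact: mx_isometry1.
by rewrite emb_id; apply: uh_refl; exact: emb_unitary.
Qed.

Lemma uh_stable n (u v : 'M[A]_n) : unitary_homotopic u v -> stable u v.
Proof. by exists n, 1%:M, 1%:M; split; rewrite ?emb_id //; exact: mx_isometry1. Qed.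

Lemma stable_refl n (u : 'M[A]_n) : is_unitary u -> stable u u.
Proof. by move=> /uh_refl/uh_stable. Qed.

Lemma stable_sym n m (u : 'M[A]_n) (v : 'M[A]_m) : stable u v -> stable v u.
Proof. by move=> [N [S [T [S1 T1 /uh_sym H]]]]; exists N, T, S. Qed.

(** Move [u] into the range of [K], apply the given homotopy there, move [v] back. *)
Lemma stable_realize n m N (u : 'M[A]_n) (v : 'M[A]_m) (S : 'M[A]_(N, n))
    (T : 'M[A]_(N, m)) Q (J : 'M[A]_(Q, n)) (J' : 'M[A]_(Q, m)) (K : 'M[A]_(Q, N)) :
  is_unitary u -> is_unitary v -> mx_isometry S -> mx_isometry T ->
  mx_isometry J -> mx_isometry J' -> mx_isometry K ->
  orthogonal_ranges J K -> orthogonal_ranges J' K ->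
  unitary_homotopic (emb S u) (emb T v) ->
  unitary_homotopic (emb J u) (emb J' v).
Proof.
move=> uu vv S1 T1 J1 J'1 K1 JK J'K H.
have place k (X : 'M[A]_(Q, k)) (Y : 'M[A]_(N, k)) w : mx_isometry X -> mx_isometry Y ->
    orthogonal_ranges X K -> is_unitary w ->
    unitary_homotopic (emb X w) (emb K (emb Y w)).
  move=> X1 Y1 XK ww; rewrite emb_comp; apply: uh_emb_orth => //.
    exact: mx_isometry_comp.
  by rewrite -[X]mulmx1; exact: orthogonal_ranges_comp.
apply: (uh_trans (place _ _ S _ J1 S1 JK uu)).
apply: (uh_trans (uh_emb K1 H)).
by apply: uh_sym; exact: place.
Qed.

Lemma stable_trans n m k (u : 'M[A]_n) (v : 'M[A]_m) (w : 'M[A]_k) :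
  is_unitary v -> stable u v -> stable v w -> stable u w.
Proof.
move=> vv [N [S [T [S1 T1 H1]]]] [M [S' [T' [S'1 T'1 H2]]]].
pose J := shiftmx A (N + M) N 0; pose K := shiftmx A (N + M) M N.
have J1 : mx_isometry J by apply: shiftmx_isometry; rewrite add0n leq_addr.
have K1 : mx_isometry K by apply: shiftmx_isometry.
have JK : orthogonal_ranges J K.
  by apply: shiftmx_orth; rewrite ?add0n ?leq_addr ?leqnn.
exists (N + M)%N, (J *m S), (K *m T'); split; try exact: mx_isometry_comp.
rewrite -!emb_comp; apply: (uh_trans (uh_emb J1 H1)).
apply: uh_trans (uh_emb K1 H2); rewrite !emb_comp.
apply: uh_emb_orth => //; try exact: mx_isometry_comp.
exact: orthogonal_ranges_comp.
Qed.

Lemma stable_mul n m (u v : 'M[A]_n) (u' v' : 'M[A]_m) :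
  is_unitary u -> is_unitary v -> is_unitary u' -> is_unitary v' ->
  stable u u' -> stable v v' -> stable (u *m v) (u' *m v').
Proof.
move=> uu vv uu' vv' [N [S [T [S1 T1 H1]]]] [M [S' [T' [S'1 T'1 H2]]]].
pose Q := (n + (m + (N + M)))%N.
pose J := shiftmx A Q n 0; pose J' := shiftmx A Q m n.
have J1 : mx_isometry J by apply: shiftmx_isometry; rewrite /Q; lia.
have J'1 : mx_isometry J' by apply: shiftmx_isometry; rewrite /Q; lia.
exists Q, J, J'; split=> //; rewrite !embM //; apply: uh_mul.
  apply: (@stable_realize _ _ N u u' S T _ J J' (shiftmx A Q N (n + m))) => //.
  - by apply: shiftmx_isometry; rewrite /Q; lia.
  - by apply: shiftmx_orth; rewrite /Q; lia.
  - by apply: shiftmx_orth; rewrite /Q; lia.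
apply: (@stable_realize _ _ M v v' S' T' _ J J' (shiftmx A Q M (n + m))) => //.
- by apply: shiftmx_isometry; rewrite /Q; lia.
- by apply: shiftmx_orth; rewrite /Q; lia.
- by apply: shiftmx_orth; rewrite /Q; lia.
Qed.

Lemma unitary_dsum n m (u : 'M[A]_n) (v : 'M[A]_m) :
  is_unitary u -> is_unitary v -> is_unitary (dsum u v).
Proof.
move=> uu vv; rewrite dsum_emb; apply: unitaryM; apply: emb_unitary => //;
  by apply: shiftmx_isometry; rewrite ?add0n ?leq_addr.
Qed.

(** The direct sum is the product of an embedded [u] and an embedded [v]. *)
Lemma stable_dsum_mul n m N (u : 'M[A]_n) (v : 'M[A]_m) (x y : 'M[A]_N) :
  is_unitary u -> is_unitary v -> is_unitary x -> is_unitary y ->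
  stable u x -> stable v y -> stable (dsum u v) (x *m y).
Proof.
move=> uu vv xx yy ux vy; rewrite dsum_emb.
have J1 : mx_isometry (shiftmx A (n + m) n 0) by apply: shiftmx_isometry; rewrite add0n leq_addr.
have K1 : mx_isometry (shiftmx A (n + m) m n) by apply: shiftmx_isometry.
apply: stable_mul => //; try exact: emb_unitary.
  by apply: stable_trans ux => //; exact: stable_emb.
by apply: stable_trans vy => //; exact: stable_emb.
Qed.

End UnitaryHomotopies.

(** * Groups of equivalence classes *)

Section ClassAlgebra.
Context (X : Type) (G : set X) (eqv : X -> X -> Prop).

Definition equivalence_on := [/\ forall x, G x -> eqv x x,
  forall x y, G x -> G y -> eqv x y -> eqv y x &
  forall x y z, G x -> G y -> G z -> eqv x y -> eqv y z -> eqv x z].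

Hypothesis Heqv : equivalence_on.

Lemma eqv_class_eq x y : G x -> G y ->
  eqv_class G eqv x = eqv_class G eqv y <-> eqv x y.
Proof.
case: Heqv => r s t Gx Gy; split=> [E|xy].
  have : eqv_class G eqv y y by split=> //; exact: r.
  by rewrite -E => -[].
apply/seteqP; split=> z [Gz ?]; split=> //.
  by apply: (t y x z) => //; exact: s.
exact: (t x y z).
Qed.

Lemma qlift_class (Y : Type) (G' : set Y) (eqv' : Y -> Y -> Prop) (f : Y -> X) y :
  (forall y', G' y' -> G (f y')) -> eqv' y y -> G' y ->
  (forall y', G' y' -> eqv' y y' -> eqv (f y) (f y')) ->
  qlift G eqv f (eqv_class G' eqv' y) = eqv_class G eqv (f y).
Proof.
move=> Gf yy Gy ff; apply/seteqP; split=> [x [y' [Gy' yy']]|x xC].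
  have <- // : eqv_class G eqv (f y) = eqv_class G eqv (f y').
  by apply/eqv_class_eq; [exact: Gf|exact: Gf|exact: ff].
by exists y.
Qed.

Variable op : X -> X -> X.
Hypothesis opG : forall x y, G x -> G y -> G (op x y).
Hypothesis op_eqv : forall x x' y y', G x -> G x' -> G y -> G y' ->
  eqv x x' -> eqv y y' -> eqv (op x y) (op x' y').

Lemma qlift2_class x y : G x -> G y ->
  qlift2 G eqv op (eqv_class G eqv x) (eqv_class G eqv y) = eqv_class G eqv (op x y).
Proof.
case: (Heqv) => r _ _ Gx Gy; apply/seteqP; split.
  move=> z [x' [Gx' xx'] [y' [Gy' yy']]].
  have <- // : eqv_class G eqv (op x y) = eqv_class G eqv (op x' y').
  by apply/eqv_class_eq; [exact: opG|exact: opG|exact: op_eqv].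
by move=> z zC; exists x; [split=> //; exact: r|exists y => //; split=> //; exact: r].
Qed.

(** The group laws need to hold only up to [eqv]. *)
Lemma class_abelian_group (z : X) : G z ->
  (forall x y w, G x -> G y -> G w -> eqv (op x (op y w)) (op (op x y) w)) ->
  (forall x y, G x -> G y -> eqv (op x y) (op y x)) ->
  (forall x, G x -> eqv (op z x) x) ->
  (forall x, G x -> exists2 y, G y & eqv (op y x) z) ->
  abelian_group_on (eqv_classes G eqv) (qlift2 G eqv op) (eqv_class G eqv z).
Proof.
move=> Gz opA opC op1 opV; split.
- by exists z.
- by move=> _ _ [x Gx <-] [y Gy <-]; rewrite qlift2_class //; exists (op x y) => //; exact: opG.
- move=> _ _ _ [x Gx <-] [y Gy <-] [w Gw <-].
  have Gyw := opG Gy Gw; have Gxy := opG Gx Gy.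
  rewrite !qlift2_class //; apply/eqv_class_eq; [exact: opG|exact: opG|exact: opA].
- move=> _ _ [x Gx <-] [y Gy <-]; rewrite !qlift2_class //.
  by apply/eqv_class_eq; [exact: opG|exact: opG|exact: opC].
- move=> _ [x Gx <-]; split.
    rewrite qlift2_class //; apply/eqv_class_eq => //; [exact: opG|exact: op1].
  have [y Gy yx] := opV x Gx; exists (eqv_class G eqv y); first by exists y.
  by rewrite qlift2_class //; apply/eqv_class_eq => //; exact: opG.
Qed.

End ClassAlgebra.

(** * The group K_1 *)

Section K1Group.
Context (R : realType) (A : ucstarType R).

(** Corner inclusions are isometries. Conversely, in a matrix algebra of size
    [m + (n + N)] a stable homotopy of size [N] can be moved to the corners. *)
Lemma stable_K1_eqv (u v : sqmx A) : is_unitary (sqval u) -> is_unitary (sqval v) ->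
  K1_eqv u v <-> stable (sqval u) (sqval v).
Proof.
case: u v => n u [m v] /= uu vv; split.
  move=> [k [l [/= e H]]].
  exists (m + l)%N, (shiftmx A _ n 0), (shiftmx A _ m 0).
  split; try by apply: shiftmx_isometry; lia.
  by move: H; rewrite (castmx_dsum1 e) dsum_emb emb1 mulmx1.
move=> [N [S [T [S1 T1 H]]]].
have e : (n + (m + N) = m + (n + N))%N by rewrite addnCA.
exists (m + N)%N, (n + N)%N, e => /=.
rewrite (castmx_dsum1 e) dsum_emb emb1 mulmx1.
apply: (@stable_realize _ _ _ _ _ _ _ S T _ _ _ (shiftmx A _ N (m + n))) => //.
all: try by apply: shiftmx_isometry; lia.
all: by apply: shiftmx_orth; lia.
Qed.

Lemma unitaries_sq (u : sqmx A) : unitaries A u -> is_unitary (sqval u).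
Proof. by case. Qed.

Lemma unitaries_dsum (u v : sqmx A) : unitaries A u -> unitaries A v ->
  unitaries A (sq_dsum u v).
Proof.
case: u v => n u [m v] [/= n0 uu] [/= m0 vv]; split=> /=; first by rewrite addn_gt0 n0.
exact: unitary_dsum.
Qed.

Lemma K1_equivalence : equivalence_on (unitaries A) (@K1_eqv R A).
Proof.
split=> [u|u v|u v w] /unitaries_sq uu.
- by apply/stable_K1_eqv => //; exact: stable_refl.
- by move=> /unitaries_sq vv /stable_K1_eqv-/(_ uu vv) /stable_sym H; apply/stable_K1_eqv.
move=> /unitaries_sq vv /unitaries_sq ww /stable_K1_eqv-/(_ uu vv) H1.
move=> /stable_K1_eqv-/(_ vv ww) H2; apply/stable_K1_eqv => //.
exact: stable_trans H1 H2.
Qed.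

(** The extension by the identity to the size [N]. *)
Definition padmx N n (u : 'M[A]_n) : 'M[A]_N := emb (shiftmx A N n 0) u.

Lemma padmx_unitary N n (u : 'M[A]_n) : (n <= N)%N -> is_unitary u ->
  is_unitary (padmx N u).
Proof. by move=> nN; apply/emb_unitary/shiftmx_isometry. Qed.

Lemma stable_padmx N n (u : 'M[A]_n) : (n <= N)%N -> is_unitary u ->
  stable u (padmx N u).
Proof.
by move=> nN uu; apply: stable_sym; apply: stable_emb => //; exact: shiftmx_isometry.
Qed.

Lemma dsum_stable n n' m m' (u : 'M[A]_n) (u' : 'M[A]_n') (v : 'M[A]_m) (v' : 'M[A]_m') :
  is_unitary u -> is_unitary u' -> is_unitary v -> is_unitary v' ->
  stable u u' -> stable v v' -> stable (dsum u v) (dsum u' v').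
Proof.
move=> uu uu' vv vv' H1 H2; pose N := (n' + m')%N.
have Hn : (n' <= N)%N by rewrite /N; lia.
have Hm : (m' <= N)%N by rewrite /N; lia.
have Pu := padmx_unitary Hn uu'; have Pv := padmx_unitary Hm vv'.
have Su := stable_padmx Hn uu'; have Sv := stable_padmx Hm vv'.
apply: (stable_trans (unitaryM Pu Pv)).
  by apply: stable_dsum_mul => //; [apply: stable_trans H1 Su|apply: stable_trans H2 Sv].
by apply: stable_sym; apply: stable_dsum_mul.
Qed.

(** The two embedded factors of a direct sum have orthogonal ranges and commute. *)
Lemma dsumC_stable n m (u : 'M[A]_n) (v : 'M[A]_m) :
  is_unitary u -> is_unitary v -> stable (dsum u v) (dsum v u).
Proof.
move=> uu vv.
have J1 : mx_isometry (shiftmx A (n + m) n 0) by apply: shiftmx_isometry; lia.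
have K1 : mx_isometry (shiftmx A (n + m) m n) by apply: shiftmx_isometry.
have JK : orthogonal_ranges (shiftmx A (n + m) n 0) (shiftmx A (n + m) m n).
  by apply: shiftmx_orth; lia.
have E : dsum u v = emb (shiftmx A (n + m) m n) v *m emb (shiftmx A (n + m) n 0) u.
  rewrite dsum_emb emb_mul_orth // emb_mul_orth; last exact: orthogonal_ranges_sym.
  by rewrite -!addrA [X in _ + X]addrC.
rewrite E; apply: stable_sym; apply: stable_dsum_mul => //.
- exact: emb_unitary.
- exact: emb_unitary.
- by apply: stable_sym; exact: stable_emb.
- by apply: stable_sym; exact: stable_emb.
Qed.

Lemma dsumA_stable n m k (u : 'M[A]_n) (v : 'M[A]_m) (w : 'M[A]_k) :
  is_unitary u -> is_unitary v -> is_unitary w ->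
  stable (dsum u (dsum v w)) (dsum (dsum u v) w).
Proof.
move=> uu vv ww; pose N := (n + m + k)%N.
have Hn : (n <= N)%N by rewrite /N; lia.
have Hm : (m <= N)%N by rewrite /N; lia.
have Hk : (k <= N)%N by rewrite /N; lia.
have Pu := padmx_unitary Hn uu; have Pv := padmx_unitary Hm vv.
have Pw := padmx_unitary Hk ww.
have Su := stable_padmx Hn uu; have Sv := stable_padmx Hm vv.
have Sw := stable_padmx Hk ww.
have Uvw := unitary_dsum vv ww; have Uuv := unitary_dsum uu vv.
apply: (stable_trans (unitaryM Pu (unitaryM Pv Pw))).
  apply: stable_dsum_mul => //; first exact: unitaryM.
  exact: stable_dsum_mul.
apply: stable_sym; rewrite mulmxA; apply: stable_dsum_mul => //; first exact: unitaryM.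
exact: stable_dsum_mul.
Qed.

Lemma stable_one n m : stable (1%:M : 'M[A]_n) (1%:M : 'M[A]_m).
Proof.
exists (n + m)%N, (shiftmx A _ n 0), (shiftmx A _ m n); split.
- by apply: shiftmx_isometry; lia.
- exact: shiftmx_isometry.
- by rewrite !emb1; exact/uh_refl/unitary1.
Qed.

Lemma dsum1_stable n m (u : 'M[A]_n) : is_unitary u -> stable (dsum (1%:M : 'M[A]_m) u) u.
Proof.
move=> uu; rewrite dsum_emb emb1 mul1mx; apply: stable_emb => //.
exact: shiftmx_isometry.
Qed.

Lemma dsum_adj_stable n m (u : 'M[A]_n) : is_unitary u ->
  stable (dsum (adjmx u) u) (1%:M : 'M[A]_m).
Proof.
move=> uu; have uu' := unitary_adj uu.
apply: (@stable_trans _ _ _ _ _ _ (adjmx u *m u)); first exact: unitaryM.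
  by apply: stable_dsum_mul => //; exact: stable_refl.
by case: uu => -> _; exact: stable_one.
Qed.

Lemma K1_op_eqv (x x' y y' : sqmx A) : unitaries A x -> unitaries A x' ->
  unitaries A y -> unitaries A y' -> K1_eqv x x' -> K1_eqv y y' ->
  K1_eqv (sq_dsum x y) (sq_dsum x' y').
Proof.
move=> Gx Gx' Gy Gy'.
have [ux ux'] := (unitaries_sq Gx, unitaries_sq Gx').
have [uy uy'] := (unitaries_sq Gy, unitaries_sq Gy').
move=> /stable_K1_eqv-/(_ ux ux') H1 /stable_K1_eqv-/(_ uy uy') H2.
apply/stable_K1_eqv; [exact: unitary_dsum|exact: unitary_dsum|exact: dsum_stable].
Qed.

Lemma K1_dsumA (x y w : sqmx A) : unitaries A x -> unitaries A y -> unitaries A w ->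
  K1_eqv (sq_dsum x (sq_dsum y w)) (sq_dsum (sq_dsum x y) w).
Proof.
move=> /unitaries_sq xx /unitaries_sq yy /unitaries_sq ww.
apply/stable_K1_eqv; [by do 2?apply: unitary_dsum|by do 2?apply: unitary_dsum|].
exact: dsumA_stable.
Qed.

Lemma K1_dsumC (x y : sqmx A) : unitaries A x -> unitaries A y ->
  K1_eqv (sq_dsum x y) (sq_dsum y x).
Proof.
move=> /unitaries_sq xx /unitaries_sq yy.
apply/stable_K1_eqv; [exact: unitary_dsum|exact: unitary_dsum|].
exact: dsumC_stable.
Qed.

Lemma K1_dsum1 (x : sqmx A) : unitaries A x ->
  K1_eqv (sq_dsum (SqMx (1%:M : 'M[A]_1)) x) x.
Proof.
move=> /unitaries_sq xx; apply/stable_K1_eqv => //.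
  by apply: unitary_dsum => //; exact: unitary1.
exact: dsum1_stable.
Qed.

Lemma K1_dsumV (x : sqmx A) : unitaries A x -> exists2 y, unitaries A y &
  K1_eqv (sq_dsum y x) (SqMx (1%:M : 'M[A]_1)).
Proof.
case: x => n x [/= n0 xx]; exists (SqMx (adjmx x)); first by split=> //; exact: unitary_adj.
apply/stable_K1_eqv; last exact: dsum_adj_stable.
  by apply: unitary_dsum => //; exact: unitary_adj.
exact: unitary1.
Qed.

Lemma K1_abelian_group : abelian_group_on (K1 A) K1_add (K1_zero A).
Proof.
apply: (class_abelian_group K1_equivalence unitaries_dsum K1_op_eqv).
- by split=> //; exact: unitary1.
- exact: K1_dsumA.
- exact: K1_dsumC.
- exact: K1_dsum1.
- exact: K1_dsumV.
Qed.

End K1Group.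

(** * Homotopies of balanced pairs *)

Section BalancedPairs.
Context (R : realType) (A : ucstarType R).
Local Notation MC n := (Mcstar A n).

Lemma balancedE n (a b : 'M[A]_n) : balanced a b <-> balR1 (MC n) a b.
Proof.
split=> [[Na Nb [H|/(@relR2_relR1 _ _ (MC n)) H]]|[Na Nb H]]; split=> //.
by left.
Qed.

Definition balanced_unitary n (a b : 'M[A]_n) : 'M[A]_n := bal_unit (MC n) a b.

Lemma balanced_unitaryE n (a b : 'M[A]_n) :
  balanced_unitary a b = 1%:M - a *m adjmx (a - b).
Proof. by []. Qed.

Lemma balanced_unitaryP n (a b : 'M[A]_n) : balanced a b -> is_unitary (balanced_unitary a b).
Proof.
move=> /balancedE[_ _ H]; split; [exact: (bal_unitVl H)|exact: (bal_unitVr H)].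
Qed.

Lemma balanced_unitary_id n (u : 'M[A]_n) : is_unitary u -> balanced_unitary u 1%:M = u.
Proof.
by move=> [_ u2]; rewrite balanced_unitaryE adjmxB adjmx1 mulmxBr u2 mulmx1 subKr.
Qed.

Lemma unitary_mxnorm n (u : 'M[A]_n) : is_unitary u -> mxnorm u <= 1.
Proof. by move=> [u1 _]; exact: (unitary_contraction (C := MC n) u1). Qed.

Lemma unitary_balanced n (u : 'M[A]_n) : is_unitary u -> balanced u 1%:M.
Proof.
move=> uu; apply/balancedE; split.
- exact: unitary_mxnorm.
- exact/unitary_mxnorm/unitary1.
- by case: uu => u1 u2; exact: (relR1_unitary (C := MC n) u1 u2).
Qed.

Lemma balanced_cor N n (S : 'M[A]_(N, n)) (a b : 'M[A]_n) : mx_isometry S ->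
  balanced a b -> balanced (cor S a) (cor S b).
Proof.
move=> S1 /balancedE[Na Nb [E1 E2 _ E4]]; apply/balancedE.
have Nc x : mxnorm x <= 1 -> mxnorm (cor S x) <= 1.
  move=> /(contractionP (MC n))[k kE]; apply/(contractionP (MC N)).
  (* The projection [f] onto the complement of the range of [S] has to be added. *)
  exists (1%:M - cor S 1%:M + cor S k).
  set f := 1%:M - cor S 1%:M.
  have fS (y : 'M[A]_n) : f *m cor S y = 0.
    by rewrite /f mulmxBl mul1mx corM // mul1mx subrr.
  have Sf (y : 'M[A]_n) : cor S y *m f = 0.
    by rewrite /f mulmxBr mulmx1 corM // mulmx1 subrr.
  have fa : adjmx f = f by rewrite /f adjmxB adjmx1 adj_cor adjmx1.
  have ff : f *m f = f by rewrite {1}/f mulmxBl mul1mx Sf subr0.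
  rewrite -[adj _ (f + _)]/(adjmx (f + cor S k)) adjmxD fa adj_cor.
  rewrite -[RHS]/((f + cor S (adjmx k)) *m (f + cor S k)).
  have fE : f = 1%:M - cor S 1%:M by [].
  clearbody f.
  have -> : (f + cor S (adjmx k)) *m (f + cor S k) = f + cor S (adjmx k *m k).
    by rewrite mulmxDl !mulmxDr ff fS Sf addr0 add0r corM.
  rewrite -[adjmx k *m k]/(adj (MC n) k * k) -kE corB.
  rewrite -[adj _ _ * _]/(adjmx (cor S x) *m cor S x) adj_cor corM //.
  by rewrite fE addrA subrK.
split; [exact: Nc|exact: Nc|].
have cM x y : cor S x * cor S y = cor S (x * y) by exact: corM.
have cA x : adj (MC N) (cor S x) = cor S (adj (MC n) x) by exact: adj_cor.
apply: relR1_intro; rewrite ?cA ?cM ?E1 ?E2 //.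
rewrite !mulrBl !mul1r ?cM -!corB; congr cor.
by move: E4; rewrite !mulrBl !mul1r E2.
Qed.

Lemma balanced_unitary_cor N n (S : 'M[A]_(N, n)) (a b : 'M[A]_n) : mx_isometry S ->
  balanced_unitary (cor S a) (cor S b) = emb S (balanced_unitary a b).
Proof.
move=> S1; rewrite !balanced_unitaryE -corB adj_cor corM //.
by rewrite /emb [1%:M - a *m _]addrC addrK corN.
Qed.

Lemma balanced_unitary_dsum n m (a b : 'M[A]_n) (c d : 'M[A]_m) :
  balanced_unitary (dsum a c) (dsum b d)
  = dsum (balanced_unitary a b) (balanced_unitary c d).
Proof.
rewrite !balanced_unitaryE /dsum opp_block_mx add_block_mx adjmx_block mulmx_block.
rewrite scalar_mx_block opp_block_mx add_block_mx.
by rewrite !oppr0 !addr0 !adjmx0 !mulmx0 !mul0mx !addr0 !add0r !oppr0.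
Qed.

Lemma homotopic_unitary n (a b c d : 'M[A]_n) : homotopic a b c d ->
  unitary_homotopic (balanced_unitary a b) (balanced_unitary c d).
Proof.
move=> [f [g [/norm_path_mxpath fc /norm_path_mxpath gc [f0 g0 f1 g1] fg]]].
exists (fun t => balanced_unitary (f t) (g t)); split.
- apply/norm_path_mxpath; apply: mxpathB; first exact: mxpath_cst.
  by apply: mxpathM => //; apply: mxpath_adj; exact: mxpathB.
- by rewrite f0 g0.
- by rewrite f1 g1.
- by move=> t /fg; exact: balanced_unitaryP.
Qed.

Lemma homotopic_sym n (a b c d : 'M[A]_n) : homotopic a b c d -> homotopic c d a b.
Proof.
move=> [f [g [/norm_path_mxpath fc /norm_path_mxpath gc [f0 g0 f1 g1] fg]]].
exists (fun t => f (1 - t)), (fun t => g (1 - t)); split.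
- by apply/norm_path_mxpath; exact: path_rev.
- by apply/norm_path_mxpath; exact: path_rev.
- by rewrite subr0 subrr.
- by move=> t /onem_mem01; exact: fg.
Qed.

Lemma homotopic_trans n (a b c d x y : 'M[A]_n) : homotopic a b c d ->
  homotopic c d x y -> homotopic a b x y.
Proof.
move=> [f [g [/norm_path_mxpath fc /norm_path_mxpath gc [f0 g0 f1 g1] fg]]].
move=> [h [k [/norm_path_mxpath hc /norm_path_mxpath kc [h0 k0 h1 k1] hk]]].
have fh : f 1 = h 0 by rewrite f1 h0.
have gk : g 1 = k 0 by rewrite g1 k0.
exists (mxglue f h), (mxglue g k); split.
- by apply/norm_path_mxpath; exact: mxglue_path.
- by apply/norm_path_mxpath; exact: mxglue_path.
- by rewrite !mxglue0 // !mxglue1.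
- move=> t /halves01[[t01 t2]|[t01 t2]].
    by rewrite !mxglue_left //; exact: fg.
  by rewrite !mxglue_right //; exact: hk.
Qed.

Lemma homotopic_cor N n (S : 'M[A]_(N, n)) (a b c d : 'M[A]_n) : mx_isometry S ->
  homotopic a b c d -> homotopic (cor S a) (cor S b) (cor S c) (cor S d).
Proof.
move=> S1 [f [g [/norm_path_mxpath fc /norm_path_mxpath gc [f0 g0 f1 g1] fg]]].
exists (fun t => cor S (f t)), (fun t => cor S (g t)); split.
- by apply/norm_path_mxpath; exact: mxpath_cor.
- by apply/norm_path_mxpath; exact: mxpath_cor.
- by rewrite f0 g0 f1 g1.
- by move=> t t01; apply: balanced_cor => //; exact: fg.
Qed.

Lemma uh_homotopic n (u v : 'M[A]_n) : unitary_homotopic u v ->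
  homotopic u 1%:M v 1%:M.
Proof.
move=> [f [fc f0 f1 fu]]; exists f, (fun=> 1%:M); split.
- exact: fc.
- by apply/norm_path_mxpath; exact: mxpath_cst.
- by rewrite f0 f1.
- by move=> t /fu; exact: unitary_balanced.
Qed.

Lemma balanced0 n : balanced (0 : 'M[A]_n) 0.
Proof.
have N0 : mxnorm (0 : 'M[A]_n) <= 1 by rewrite -[leLHS]/(nrm (MC n) 0) nrm0 ler01.
by split=> //; left.
Qed.

Lemma balanced_dsum n m (a b : 'M[A]_n) (c d : 'M[A]_m) :
  balanced a b -> balanced c d -> balanced (dsum a c) (dsum b d).
Proof.
move=> /balancedE[Na Nb [E1 E2 _ E4]] /balancedE[Nc Nd [F1 F2 _ F4]].
have dM (x y : 'M[A]_n) (z t : 'M[A]_m) : dsum x z * dsum y t = dsum (x * y) (z * t).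
  by rewrite -[LHS]/(_ *m _) mulmx_block !mulmx0 !mul0mx !addr0 add0r.
have dA (x : 'M[A]_n) (y : 'M[A]_m) :
    adj (MC (n + m)) (dsum x y) = dsum (adj (MC n) x) (adj (MC m) y).
  by rewrite -[LHS]/(adjmx _) adjmx_block !adjmx0.
have d1 (x : 'M[A]_n) (y : 'M[A]_m) : 1 - dsum x y = dsum (1 - x) (1 - y).
  rewrite -[LHS]/(1%:M - dsum x y) scalar_mx_block /dsum opp_block_mx add_block_mx.
  by rewrite !oppr0 !addr0.
have Nds (x : 'M[A]_n) (y : 'M[A]_m) : mxnorm x <= 1 -> mxnorm y <= 1 ->
    mxnorm (dsum x y) <= 1.
  move=> /(contractionP (MC n))[k kE] /(contractionP (MC m))[l lE].
  by apply/(contractionP (MC _)); exists (dsum k l); rewrite !dA !dM d1 kE lE.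
apply/balancedE; split; [exact: Nds|exact: Nds|].
apply: relR1_intro; rewrite !dA !dM.
- by rewrite E1 F1.
- by rewrite E2 F2.
- by rewrite !d1 !dM E4 F4.
Qed.

Section Rotate.
Context (n : nat) (a b e v : 'M[A]_n).
Hypothesis Bab : balanced a b.
Hypothesis (ee : adjmx e = e).
Hypothesis (ea : e *m a = a) (ae : a *m e = a) (eb : e *m b = b) (be : b *m e = b).
Hypothesis (vv : v *m adjmx v = e) (ve : v *m e = 0) (ev : e *m v = v).
Let w := balanced_unitary a b.

(** The path of [rotation_balR1]. *)
Lemma homotopic_rotate : homotopic a b (w *m v) v.
Proof.
exists (fun t => msc A n (rcos t) *m a + msc A n (rsin t) *m (w *m v)).
exists (fun t => msc A n (rcos t) *m b + msc A n (rsin t) *m v).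
have P (x y : 'M[A]_n) :
    mxpath (fun t => msc A n (rcos t) *m x + msc A n (rsin t) *m y).
  apply: mxpathD; apply: mxpathM; try exact: (mxpath_cst x); try exact: (mxpath_cst y).
    by apply: mxpath_msc; exact: rcos_continuous.
  by apply: mxpath_msc; exact: rsin_continuous.
split; [by apply/norm_path_mxpath|by apply/norm_path_mxpath| |].
  by rewrite rcos0 rsin0 rcos1 rsin1 !msc0 !msc1 !mul0mx !mul1mx !addr0 !add0r.
move=> t /rcos_rsin t01; apply/balancedE.
by have := Bab; rewrite balancedE => B; exact: (rotation_balR1 B ee ea ae eb be vv ve ev t01).
Qed.

End Rotate.

(** Both [(a, b)] and [(w e, e)] rotate to [(w v, v)], because they have the same
    unitary [w]; then the complement of [e] is filled. *)
Lemma homotopic_bal_unit n (a b e v : 'M[A]_n) : balanced a b ->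
  adjmx e = e -> e *m a = a -> a *m e = a -> e *m b = b -> b *m e = b ->
  v *m adjmx v = e -> v *m e = 0 -> e *m v = v ->
  homotopic a b (balanced_unitary a b) 1%:M.
Proof.
move=> Bab ee ea ae eb be vv ve ev; set w := balanced_unitary a b.
have B : balR1 (MC n) a b by apply/balancedE.
have e2 : e *m e = e by exact: (support_idem (C := MC n) vv ev).
have ew : e *m w = w *m e by exact: (bal_unit_comm (C := MC n) ee ea eb).
have woff : w *m (1%:M - e) = 1%:M - e by exact: (bal_unit_off (C := MC n) ee ea eb).
have [w1 w2] : is_unitary w by exact: balanced_unitaryP.
apply: homotopic_trans (homotopic_rotate Bab ee ea ae eb be vv ve ev) _.
have fill : homotopic (w *m e) e w 1%:M.
  exists (fun t => w *m e + msc A n t *m (1%:M - e)).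
  exists (fun t => e + msc A n t *m (1%:M - e)).
  have P (x y : 'M[A]_n) : mxpath (fun t => x + msc A n t *m y).
    apply: mxpathD; first exact: mxpath_cst.
    apply: mxpathM; last exact: mxpath_cst.
    by apply: (mxpath_msc _ _ (h := id)) => t; exact: cvg_id.
  split; [by apply/norm_path_mxpath|by apply/norm_path_mxpath| |].
    rewrite !msc0 !msc1 !mul0mx !mul1mx !addr0; split=> //.
      by rewrite -woff -mulmxDr addrC subrK mulmx1.
    by rewrite addrC subrK.
  move=> t t01; apply/balancedE.
  apply: (filling_balR1 (C := MC n) w1 w2 ee e2 ew).
  by move: t01; rewrite in_itv.
have Bwe : balanced (w *m e) e.
  have [f [g [_ _ [f0 g0 _ _] H]]] := fill.
  by have := H 0 (mem01_0 R); rewrite f0 g0.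
have wE : balanced_unitary (w *m e) e = w.
  rewrite balanced_unitaryE adjmxB adjmxM ee mulmxBr.
  have -> : w *m e *m (e *m adjmx w) = e.
    by rewrite mulmxA -(mulmxA w e e) e2 -ew -mulmxA w2 mulmx1.
  rewrite -mulmxA e2 opprB addrCA -woff -mulmxDr.
  by rewrite addrC subrK mulmx1.
have R2 := homotopic_rotate Bwe ee _ _ e2 e2 vv ve ev.
rewrite wE in R2; apply: homotopic_trans (homotopic_sym (R2 _ _)) fill.
  by rewrite mulmxA ew -mulmxA e2.
by rewrite -mulmxA e2.
Qed.

(** The range of [K] provides the room for the rotation. *)
Lemma homotopic_cor_bal_unit n Q (J K : 'M[A]_(Q, n)) (a b : 'M[A]_n) :
  mx_isometry J -> mx_isometry K -> orthogonal_ranges J K -> balanced a b ->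
  homotopic (cor J a) (cor J b) (emb J (balanced_unitary a b)) 1%:M.
Proof.
move=> J1 K1 JK Bab; rewrite -balanced_unitary_cor //.
have KJ := orthogonal_ranges_sym JK.
apply: (@homotopic_bal_unit _ _ _ (cor J 1%:M) (J *m adjmx K)).
- exact: balanced_cor.
- by rewrite adj_cor adjmx1.
- by rewrite corM // mul1mx.
- by rewrite corM // mulmx1.
- by rewrite corM // mul1mx.
- by rewrite corM // mulmx1.
- by rewrite adjmxM adjmxK mulmxA -(mulmxA J) K1.
- by rewrite /cor mulmx1 mulmxA -(mulmxA J) KJ mulmx0 mul0mx.
- by rewrite /cor mulmx1 mulmxA -(mulmxA J (adjmx J)) J1 mulmx1.
Qed.

End BalancedPairs.

(** * The group L_1 and its comparison with K_1 *)

Section L1Group.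
Context (R : realType) (A : ucstarType R).

Definition pair_unitary (p : mxpair A) : sqmx A :=
  SqMx (balanced_unitary (pfst p) (psnd p)).

Lemma pair_unitaryP p : balanced_pairs A p -> unitaries A (pair_unitary p).
Proof. by move=> [p0 Bp]; split=> //; exact: balanced_unitaryP. Qed.

(** The unitary of a pair follows homotopies, and the unitary of a homotopy trivial
    summand is homotopic to 1. *)
Lemma L1_eqv_stable (p q : mxpair A) : balanced_pairs A p -> balanced_pairs A q ->
  L1_eqv p q -> stable (sqval (pair_unitary p)) (sqval (pair_unitary q)).
Proof.
case: p q => n a b [m c d] [/= n0 Bab] [/= m0 Bcd].
move=> [k [l [/= e [r [x [y [r0 Hxy H]]]]]]].
set u := balanced_unitary a b; set v := balanced_unitary c d.
have uu : is_unitary u by exact: balanced_unitaryP.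
have vv : is_unitary v by exact: balanced_unitaryP.
set z := balanced_unitary x y.
have z1 : unitary_homotopic z 1%:M.
  have := homotopic_unitary Hxy; rewrite -/z balanced_unitaryE.
  by rewrite mul0mx subr0.
pose N := (m + l)%N; pose J := shiftmx A (N + r) N 0; pose K := shiftmx A (N + r) r N.
have J1 : mx_isometry J by apply: shiftmx_isometry; lia.
have K1 : mx_isometry K by exact: shiftmx_isometry.
pose S := shiftmx A N n 0; pose T := shiftmx A N m 0.
have S1 : mx_isometry S by apply: shiftmx_isometry; rewrite /N; lia.
have T1 : mx_isometry T by apply: shiftmx_isometry; rewrite /N; lia.
rewrite !(castmx_corner e) /corner -!cor_left -/S -/T in H.
have H1 : unitary_homotopic (emb J (emb S u) *m emb K z) (emb J (emb T v) *m emb K z).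
  have := homotopic_unitary H.
  by rewrite !balanced_unitary_dsum -/z !balanced_unitary_cor // !dsum_emb.
have Kz : unitary_homotopic (emb K z) 1%:M by rewrite -(emb1 K); exact: uh_emb.
exists (N + r)%N, (J *m S), (J *m T); split.
- exact: mx_isometry_comp.
- exact: mx_isometry_comp.
rewrite -!emb_comp -[emb J (emb S u)]mulmx1 -[emb J (emb T v)]mulmx1.
apply: uh_trans (uh_trans H1 (uh_mul (uh_refl _) Kz)).
  by apply: uh_mul; [apply: uh_refl; do 2?apply: emb_unitary|exact: uh_sym].
by do 2?apply: emb_unitary.
Qed.

(** In a corner of a large matrix algebra, both pairs are homotopic to [(w, 1)] for
    their unitaries [w], which are homotopic there. *)
Lemma stable_L1_eqv (p q : mxpair A) : balanced_pairs A p -> balanced_pairs A q ->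
  stable (sqval (pair_unitary p)) (sqval (pair_unitary q)) -> L1_eqv p q.
Proof.
case: p q => n a b [m c d] [/= n0 Bab] [/= m0 Bcd].
set u := balanced_unitary a b; set v := balanced_unitary c d.
have uu : is_unitary u by exact: balanced_unitaryP.
have vv : is_unitary v by exact: balanced_unitaryP.
move=> [N [S [T [S1 T1 H]]]].
pose k := (m + (N + (n + m)))%N; pose l := (n + (N + (n + m)))%N.
have e : (n + k = m + l)%N by rewrite /k /l addnCA.
pose Q := (m + l)%N; pose J := shiftmx A Q n 0; pose J' := shiftmx A Q m 0.
have iso r i : (i + r <= Q)%N -> mx_isometry (shiftmx A Q r i) by exact: shiftmx_isometry.
have J1 : mx_isometry J by apply: iso; rewrite /Q /l; lia.
have J'1 : mx_isometry J' by apply: iso; rewrite /Q /l; lia.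
have pq : homotopic (cor J a) (cor J b) (cor J' c) (cor J' d).
  apply: (@homotopic_trans _ _ _ _ _ (emb J u) 1%:M).
    apply: (@homotopic_cor_bal_unit _ _ _ _ _ (shiftmx A Q n (m + n + N))) => //.
      by apply: iso; rewrite /Q /l; lia.
    by apply: shiftmx_orth; rewrite /Q /l; lia.
  apply: (@homotopic_trans _ _ _ _ _ (emb J' v) 1%:M).
    apply: uh_homotopic.
    apply: (@stable_realize _ _ _ _ N u v S T _ _ _ (shiftmx A Q N (m + n))) => //.
    - by apply: iso; rewrite /Q /l; lia.
    - by apply: shiftmx_orth; rewrite /Q /l; lia.
    - by apply: shiftmx_orth; rewrite /Q /l; lia.
  apply: homotopic_sym.
  apply: (@homotopic_cor_bal_unit _ _ _ _ _ (shiftmx A Q m (m + n + N))) => //.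
    by apply: iso; rewrite /Q /l; lia.
  by apply: shiftmx_orth; rewrite /Q /l; lia.
exists k, l, e, 1%N, 0, 0; split=> //=.
  exists (fun=> 0), (fun=> 0); split=> //.
  - by apply/norm_path_mxpath; exact: mxpath_cst.
  - by apply/norm_path_mxpath; exact: mxpath_cst.
  - by move=> t _; exact: balanced0.
rewrite !(castmx_corner e) /corner -!cor_left.
by apply: homotopic_cor pq; apply: shiftmx_isometry; rewrite add0n leq_addr.
Qed.

(** Through this equivalence the properties of L_1 are those of K_1. *)
Lemma L1_eqvE (p q : mxpair A) : balanced_pairs A p -> balanced_pairs A q ->
  L1_eqv p q <-> K1_eqv (pair_unitary p) (pair_unitary q).
Proof.
move=> Bp Bq; have [_ up] := pair_unitaryP Bp; have [_ uq] := pair_unitaryP Bq.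
rewrite stable_K1_eqv //; split; [exact: L1_eqv_stable|exact: stable_L1_eqv].
Qed.

Lemma L1_equivalence : equivalence_on (balanced_pairs A) (@L1_eqv R A).
Proof.
have [r s t] := K1_equivalence A; split.
- by move=> p Bp; apply/L1_eqvE => //; apply: r; exact: pair_unitaryP.
- move=> p q Bp Bq /L1_eqvE-/(_ Bp Bq) H; apply/L1_eqvE => //.
  by apply: s => //; exact: pair_unitaryP.
move=> p q w Bp Bq Bw /L1_eqvE-/(_ Bp Bq) H1 /L1_eqvE-/(_ Bq Bw) H2.
apply/L1_eqvE => //; apply: t H1 H2; exact: pair_unitaryP.
Qed.

Lemma balanced_pairs_dsum (p q : mxpair A) : balanced_pairs A p -> balanced_pairs A q ->
  balanced_pairs A (pair_dsum p q).
Proof.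
case: p q => n a b [m c d] [/= n0 Bab] [/= m0 Bcd]; split; first by rewrite /= addn_gt0 n0.
exact: balanced_dsum.
Qed.

Lemma pair_unitary_dsum (p q : mxpair A) :
  pair_unitary (pair_dsum p q) = sq_dsum (pair_unitary p) (pair_unitary q).
Proof. by rewrite /pair_unitary /= balanced_unitary_dsum. Qed.

Lemma pair_unitary_id (u : sqmx A) : unitaries A u -> pair_unitary (unitary_pair u) = u.
Proof. by case: u => n u [/= _ uu]; rewrite /pair_unitary /= balanced_unitary_id. Qed.

Lemma unitary_pair_balanced (u : sqmx A) : unitaries A u ->
  balanced_pairs A (unitary_pair u).
Proof. by move=> [n0 uu]; split=> //; exact: unitary_balanced. Qed.

Lemma L1_op_eqv (x x' y y' : mxpair A) : balanced_pairs A x -> balanced_pairs A x' ->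
  balanced_pairs A y -> balanced_pairs A y' -> L1_eqv x x' -> L1_eqv y y' ->
  L1_eqv (pair_dsum x y) (pair_dsum x' y').
Proof.
move=> Bx Bx' By By' /L1_eqvE-/(_ Bx Bx') H1 /L1_eqvE-/(_ By By') H2.
apply/L1_eqvE; try exact: balanced_pairs_dsum.
by rewrite !pair_unitary_dsum; apply: K1_op_eqv => //; exact: pair_unitaryP.
Qed.

Lemma zero_pair : balanced_pairs A (MxPair (0 : 'M[A]_1) 0).
Proof. by split=> //; exact: balanced0. Qed.

Lemma pair_unitary_zero : pair_unitary (MxPair (0 : 'M[A]_1) 0) = SqMx (1%:M : 'M[A]_1).
Proof. by rewrite /pair_unitary /= balanced_unitaryE mul0mx subr0. Qed.

Lemma L1_abelian_group : abelian_group_on (L1 A) L1_add (L1_zero A).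
Proof.
have [rK sK tK] := K1_equivalence A.
have bd := balanced_pairs_dsum; have pu := pair_unitaryP.
apply: (class_abelian_group L1_equivalence bd L1_op_eqv zero_pair).
- move=> x y w Bx By Bw; apply/L1_eqvE.
  + exact: bd _ _ Bx (bd _ _ By Bw).
  + exact: bd _ _ (bd _ _ Bx By) Bw.
 
  rewrite !pair_unitary_dsum; exact: K1_dsumA (pu _ Bx) (pu _ By) (pu _ Bw).
- move=> x y Bx By; apply/L1_eqvE; [exact: bd|exact: bd|].
  rewrite !pair_unitary_dsum; exact: K1_dsumC (pu _ Bx) (pu _ By).
- move=> x Bx; apply/L1_eqvE => //; first exact: bd _ _ zero_pair Bx.
  rewrite pair_unitary_dsum pair_unitary_zero; exact: K1_dsum1 (pu _ Bx).
move=> x Bx; have [y Gy yx] := K1_dsumV (pu _ Bx).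
have By := unitary_pair_balanced Gy; exists (unitary_pair y) => //.
apply/L1_eqvE; [exact: bd|exact: zero_pair|].
by rewrite pair_unitary_dsum pair_unitary_zero pair_unitary_id.
Qed.

Lemma iota1_class (u : sqmx A) : unitaries A u ->
  iota1 (K1_class u) = L1_class (unitary_pair u).
Proof.
move=> Gu; have [rK _ _] := K1_equivalence A.
apply: (qlift_class L1_equivalence) => //; first exact: unitary_pair_balanced.
  exact: rK.
move=> v Gv uv; apply/L1_eqvE; try exact: unitary_pair_balanced.
by rewrite !pair_unitary_id.
Qed.

Lemma K1_add_class (u v : sqmx A) : unitaries A u -> unitaries A v ->
  K1_add (K1_class u) (K1_class v) = K1_class (sq_dsum u v).
Proof.
exact: (qlift2_class (K1_equivalence A) (@unitaries_dsum R A) (@K1_op_eqv R A)).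
Qed.

Lemma L1_add_class (p q : mxpair A) : balanced_pairs A p -> balanced_pairs A q ->
  L1_add (L1_class p) (L1_class q) = L1_class (pair_dsum p q).
Proof. exact: (qlift2_class L1_equivalence balanced_pairs_dsum L1_op_eqv). Qed.

Lemma iota1_add (x y : set (sqmx A)) : K1 A x -> K1 A y ->
  iota1 (K1_add x y) = L1_add (iota1 x) (iota1 y).
Proof.
move=> [u Gu <-] [v Gv <-].
have [Bu Bv] := (unitary_pair_balanced Gu, unitary_pair_balanced Gv).
have Guv := unitaries_dsum Gu Gv; have Buv := unitary_pair_balanced Guv.
rewrite -!/(K1_class _) K1_add_class // !iota1_class // L1_add_class //.
apply/(eqv_class_eq L1_equivalence) => //; first exact: balanced_pairs_dsum.
apply/L1_eqvE => //; first exact: balanced_pairs_dsum.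
rewrite pair_unitary_dsum !pair_unitary_id //.
by have [rK _ _] := K1_equivalence A; exact: rK.
Qed.

Lemma iota1_bij : set_bij (K1 A) (L1 A) iota1.
Proof.
split.
- move=> _ [u Gu <-] /=; rewrite iota1_class //; exists (unitary_pair u) => //.
  exact: unitary_pair_balanced.
- move=> x y; rewrite !inE => -[u Gu <-] [v Gv <-]; rewrite !iota1_class //.
  have [Bu Bv] := (unitary_pair_balanced Gu, unitary_pair_balanced Gv).
  move=> /(eqv_class_eq L1_equivalence Bu Bv) /L1_eqvE-/(_ Bu Bv).
  by rewrite !pair_unitary_id // => uv; apply/(eqv_class_eq (K1_equivalence A)).
move=> _ [p Bp <-]; have Gp := pair_unitaryP Bp.
exists (K1_class (pair_unitary p)); first by exists (pair_unitary p).
rewrite iota1_class //; apply/(eqv_class_eq L1_equivalence) => //.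
  exact: unitary_pair_balanced.
apply/L1_eqvE => //; first exact: unitary_pair_balanced.
by rewrite pair_unitary_id //; have [rK _ _] := K1_equivalence A; exact: rK.
Qed.

End L1Group.

(** * Naturality *)

Section Functoriality.
Context (R : realType) (A B : ucstarType R) (phi : A -> B).
Hypothesis Hphi : unital_star_hom phi.

Let phiD x y : phi (x + y) = phi x + phi y.
Proof. by case: Hphi => L _ _; have := L 1 x y; rewrite !scale1r. Qed.

Let phi0 : phi 0 = 0.
Proof. by apply: (addrI (phi 0)); rewrite -phiD !addr0. Qed.

Let phiN x : phi (- x) = - phi x.
Proof. by apply: (addrI (phi x)); rewrite -phiD !subrr phi0. Qed.

Let phi1 : phi 1 = 1. Proof. by case: Hphi => _ [H _] _. Qed.

Let phiM x y : phi (x * y) = phi x * phi y. Proof. by case: Hphi => _ [_ H] _. Qed.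

Let phi_star x : phi (star x) = star (phi x). Proof. by case: Hphi. Qed.

Let phi_asc r : phi (asc A r) = asc B r.
Proof.
by case: Hphi => L _ _; have := L (r%:C)%C 1 0; rewrite !addr0 phi0 addr0 phi1.
Qed.

Let phi_sum I (r : seq I) (P : pred I) (F : I -> A) :
  phi (\sum_(i <- r | P i) F i) = \sum_(i <- r | P i) phi (F i).
Proof. by apply: (big_morph _ phiD phi0). Qed.

(** Contractivity is preserved as an algebraic property; scaling gives the rest. *)
Lemma hom_nA_le x : nA (phi x) <= nA x.
Proof.
have c y : nA y <= 1 -> nA (phi y) <= 1.
  move=> /(contractionP (Acstar A))[k kE]; apply/(contractionP (Acstar B)).
  exists (phi k); have := congr1 phi kE.
  by rewrite phiD phiN phi1 !phiM -[adj (Acstar A) _]/(star _)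
             -[adj (Acstar A) k]/(star k) !phi_star.
have := nA_ge0 x; rewrite le_eqVlt => /orP[/eqP E|x0].
  by rewrite (nA_eq0 (esym E)) phi0 !nA0.
set r := (nA x)^-1; have r0 : 0 < r by rewrite invr_gt0.
have /c : nA (asc A r * x) <= 1 by rewrite nA_ascM gtr0_norm // mulVf // gt_eqF.
by rewrite phiM phi_asc nA_ascM gtr0_norm // mulrC ler_pdivrMr // mul1r.
Qed.

Lemma map_mxpath m n (f : R -> 'M[A]_(m, n)) : mxpath f ->
  mxpath (fun t => map_mx phi (f t)).
Proof.
move=> fc i j t t01 e e0; near=> s => s01.
rewrite !mxE -phiN -phiD; apply: le_lt_trans (hom_nA_le _) _.
by move: s01; near: s; exact: fc.
Unshelve. all: by end_near. Qed.

Lemma map_mulmx m n p (S : 'M[A]_(m, n)) (T : 'M[A]_(n, p)) :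
  map_mx phi (S *m T) = map_mx phi S *m map_mx phi T.
Proof.
apply/matrixP => i j; rewrite !mxE phi_sum; apply: eq_bigr => k _.
by rewrite phiM !mxE.
Qed.

Lemma map_addmx m n (S T : 'M[A]_(m, n)) :
  map_mx phi (S + T) = map_mx phi S + map_mx phi T.
Proof. by apply/matrixP => i j; rewrite !mxE phiD. Qed.

Lemma map_oppmx m n (S : 'M[A]_(m, n)) : map_mx phi (- S) = - map_mx phi S.
Proof. by apply/matrixP => i j; rewrite !mxE phiN. Qed.

Lemma map_onemx n : map_mx phi (1%:M : 'M[A]_n) = 1%:M.
Proof. by apply/matrixP => i j; rewrite !mxE; case: eqP => _; rewrite ?mulr1n ?mulr0n. Qed.

Lemma map_adjmx m n (S : 'M[A]_(m, n)) : map_mx phi (adjmx S) = adjmx (map_mx phi S).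
Proof. by apply/matrixP => i j; rewrite !mxE phi_star. Qed.

Lemma map_emb N n (S : 'M[A]_(N, n)) u :
  map_mx phi (emb S u) = emb (map_mx phi S) (map_mx phi u).
Proof.
by rewrite /emb /cor map_addmx map_onemx !map_mulmx map_adjmx map_addmx map_oppmx map_onemx.
Qed.

Lemma map_isometry N n (S : 'M[A]_(N, n)) : mx_isometry S -> mx_isometry (map_mx phi S).
Proof. by move=> S1; rewrite /mx_isometry -map_adjmx -map_mulmx S1 map_onemx. Qed.

Lemma map_unitary n (u : 'M[A]_n) : is_unitary u -> is_unitary (map_mx phi u).
Proof. by move=> [u1 u2]; split; rewrite -map_adjmx -map_mulmx ?u1 ?u2 map_onemx. Qed.

Lemma map_balanced n (a b : 'M[A]_n) : balanced a b ->
  balanced (map_mx phi a) (map_mx phi b).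
Proof.
have c (x : 'M[A]_n) : mxnorm x <= 1 -> mxnorm (map_mx phi x) <= 1.
  move=> /(contractionP (Mcstar A n))[k kE]; apply/(contractionP (Mcstar B n)).
  exists (map_mx phi k); have := congr1 (map_mx phi) kE.
  rewrite -[1 - _]/(1%:M - adjmx x *m x) -[_ * k]/(adjmx k *m k).
  by rewrite map_addmx map_oppmx map_onemx !map_mulmx !map_adjmx.
move=> /balancedE[Na Nb [E1 E2 E3 E4]]; split; [exact: c|exact: c|left].
rewrite /balancedR1 -!map_adjmx -!map_mulmx -!map_onemx -!map_oppmx -!map_addmx -!map_mulmx.
by split; congr map_mx.
Qed.

Lemma map_stable n m (u : 'M[A]_n) (v : 'M[A]_m) : stable u v ->
  stable (map_mx phi u) (map_mx phi v).
Proof.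
move=> [N [S [T [S1 T1 [f [/norm_path_mxpath fc f0 f1 fu]]]]]].
exists N, (map_mx phi S), (map_mx phi T); split; [exact: map_isometry|exact: map_isometry|].
exists (fun t => map_mx phi (f t)); split.
- by apply/norm_path_mxpath; exact: map_mxpath.
- by rewrite f0 map_emb.
- by rewrite f1 map_emb.
- by move=> t /fu; exact: map_unitary.
Qed.

Lemma sq_map_unitaries (u : sqmx A) : unitaries A u -> unitaries B (sq_map phi u).
Proof. by move=> [u0 uu]; split=> //; exact: map_unitary. Qed.

Lemma pair_map_balanced (p : mxpair A) : balanced_pairs A p ->
  balanced_pairs B (pair_map phi p).
Proof. by move=> [p0 Bp]; split=> //; exact: map_balanced. Qed.

Lemma K1_eqv_map (u v : sqmx A) : unitaries A u -> unitaries A v -> K1_eqv u v ->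
  K1_eqv (sq_map phi u) (sq_map phi v).
Proof.
move=> [_ uu] [_ vv] /stable_K1_eqv-/(_ uu vv) H; apply/stable_K1_eqv.
- exact: map_unitary.
- exact: map_unitary.
- exact: map_stable.
Qed.

Lemma pair_unitary_map (p : mxpair A) :
  pair_unitary (pair_map phi p) = sq_map phi (pair_unitary p).
Proof.
rewrite /pair_unitary /sq_map /= !balanced_unitaryE; congr SqMx.
by rewrite map_addmx map_oppmx map_onemx map_mulmx map_adjmx map_addmx map_oppmx.
Qed.

Lemma L1_eqv_map (p q : mxpair A) : balanced_pairs A p -> balanced_pairs A q ->
  L1_eqv p q -> L1_eqv (pair_map phi p) (pair_map phi q).
Proof.
move=> Bp Bq /L1_eqvE-/(_ Bp Bq) H; apply/L1_eqvE; try exact: pair_map_balanced.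
by rewrite !pair_unitary_map; apply: K1_eqv_map => //; exact: pair_unitaryP.
Qed.

Lemma K1_map_class (u : sqmx A) : unitaries A u ->
  K1_map phi (K1_class u) = K1_class (sq_map phi u).
Proof.
move=> Gu; have [rK _ _] := K1_equivalence A.
apply: (qlift_class (K1_equivalence B)) => //; first exact: sq_map_unitaries.
  exact: rK.
by move=> v Gv; exact: K1_eqv_map.
Qed.

Lemma L1_map_class (p : mxpair A) : balanced_pairs A p ->
  L1_map phi (L1_class p) = L1_class (pair_map phi p).
Proof.
move=> Gp; have [rL _ _] := L1_equivalence A.
apply: (qlift_class (L1_equivalence B)) => //; first exact: pair_map_balanced.
  exact: rL.
by move=> q Gq; exact: L1_eqv_map.
Qed.

Lemma iota1_natural (x : set (sqmx A)) : K1 A x ->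
  L1_map phi (iota1 x) = iota1 (K1_map phi x).
Proof.
move=> [u Gu <-]; have Bu := unitary_pair_balanced Gu.
rewrite -!/(K1_class u) K1_map_class // !iota1_class //; last exact: sq_map_unitaries.
rewrite L1_map_class //; congr L1_class.
by rewrite /pair_map /unitary_pair /= map_onemx.
Qed.

End Functoriality.

Theorem theorem2p9 (R : realType) :
  (forall A : ucstarType R,
     [/\ abelian_group_on (K1 A) K1_add (K1_zero A),
         abelian_group_on (L1 A) L1_add (L1_zero A),
         (forall u : sqmx A, unitaries A u ->
            iota1 (K1_class u) = L1_class (unitary_pair u)),
         (forall x y : set (sqmx A), K1 A x -> K1 A y ->
            iota1 (K1_add x y) = L1_add (iota1 x) (iota1 y)) &
         set_bij (K1 A) (L1 A) iota1]) /\
  (forall (A B : ucstarType R) (phi : A -> B), unital_star_hom phi ->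
     [/\ (forall u : sqmx A, unitaries A u ->
            unitaries B (sq_map phi u) /\
            K1_map phi (K1_class u) = K1_class (sq_map phi u)),
         (forall p : mxpair A, balanced_pairs A p ->
            balanced_pairs B (pair_map phi p) /\
            L1_map phi (L1_class p) = L1_class (pair_map phi p)) &
         forall x : set (sqmx A), K1 A x ->
           L1_map phi (iota1 x) = iota1 (K1_map phi x)]).
Proof.
split=> [A|A B phi Hphi]; split.
- exact: K1_abelian_group.
- exact: L1_abelian_group.
- exact: iota1_class.
- exact: iota1_add.
- exact: iota1_bij.
- by move=> u Gu; split; [exact: sq_map_unitaries|exact: K1_map_class].
- by move=> p Bp; split; [exact: pair_map_balanced|exact: L1_map_class].
- exact: iota1_natural.
Qed.
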